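(* Let $\psi:M\to\overline{M}$ be an $n$-dimensional spacelike hypersurface of constant mean curvature $H$ immersed in a Lorentzian warped product $\overline{M}=I\times_f F$ satisfying the Timelike Convergence Condition. Then, on $M$, $$\cosh\varphi\,\Delta\cosh\varphi \geq \sinh^2\varphi\left(\frac{n}{2}H+\frac{f'(\tau)}{f(\tau)}\cosh\varphi\right)^2+n\sinh^2\varphi\left(\frac{f'(\tau)^2}{f(\tau)^2}-\frac{n}{4}H^2\right)+\frac{f'(\tau)^2}{f(\tau)^2}\sinh^4\varphi .$$
   Context: Let $n\ge 2$, let $(F,g_F)$ be a connected $n$-dimensional Riemannian manifold, $I\subset\mathbb{R}$ an open interval and $f:I\to(0,\infty)$ smooth. The Lorentzian warped product $\overline{M}=I\times_f F$ is $I\times F$ with the Lorentzian metric $\bar g=-\pi_I^*(dt^2)+f(\pi_I)^2\pi_F^*(g_F)$, where $\pi_I,\pi_F$ are the projections; $\partial_t=\partial/\partial t$ is the unit timelike coordinate vector field. $\overline{M}$ satisfies the Timelike Convergence Condition (TCC) if its Ricci tensor satisfies $\overline{\mathrm{Ric}}(z,z)\ge 0$ for every timelike vector $z$. A spacelike hypersurface is an immersion $\psi:M\to\overline{M}$ of an $n$-dimensional manifold $M$ whose induced metric $g_M$ is Riemannian; $\Delta$ is the Laplacian (trace of the Hessian) of $(M,g_M)$. Put $\tau=\pi_I\circ\psi$, $f(\tau)=f\circ\tau$, $f'(\tau)=f'\circ\tau$. Let $N$ be the unique unit timelike normal vector field along $\psi$ with the same time-orientation as $-\partial_t$, i.e.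 $\bar g(N,\partial_t)>0$. The shape operator is $AX=-\overline{\nabla}_XN$ and the mean curvature is $H=-\frac1n\mathrm{trace}(A)$. The hyperbolic angle $\varphi\ge 0$ is the function on $M$ defined by $\cosh\varphi=\bar g(N,\partial_t)$. *)

(* Defs.v *)
From mathcomp Require Import all_boot all_order all_algebra.
From mathcomp Require Import all_classical all_reals all_analysis.

Set Implicit Arguments.
Unset Strict Implicit.
Unset Printing Implicit Defensive.

Import Order.TTheory GRing.Theory Num.Theory.
Import numFieldNormedType.Exports.

Local Open Scope classical_set_scope.
Local Open Scope ring_scope.

Definition cosh (R : realType) (x : R) : R := (expR x + expR (- x)) / 2.
Definition sinh (R : realType) (x : R) : R := (expR x - expR (- x)) / 2.

(* [Ck_on k U f]: f is of class C^k on the open set U (V is always a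
   finite-dimensional space below, so that continuity of all iterated
   directional derivatives is continuity of the iterated differentials). *)
Fixpoint Ck_on (R : realType) (V W : normedModType R) (k : nat)
    (U : set V) (f : V -> W) : Prop :=
  match k with
  | 0 => forall x, U x -> {for x, continuous f}
  | k'.+1 => (forall x, U x -> differentiable f x) /\
             forall v : V, Ck_on k' U (fun x => 'D_v f x)
  end.

Definition smooth_on (R : realType) (V W : normedModType R)
    (U : set V) (f : V -> W) : Prop :=
  forall k, Ck_on k U f.

(* The data of an n-dimensional atlas. [param a] is the inverse of [coord a];
   its values outside [coord a @` dom a] and those of [coord a] outside [dom a]
   are irrelevant. The manifold is the union of the [dom a], which may be a
   proper open subset of the ambient space T. *)
Record atlas (R : realType) (n : nat) (T : Type) : Type := Atlas {
  chart : Type;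
  dom : chart -> set T;
  coord : chart -> T -> 'rV[R]_n;
  param : chart -> 'rV[R]_n -> T }.

Definition rep (R : realType) (m n : nat) (S T : Type)
    (A : atlas R m S) (B : atlas R n T) (h : S -> T)
    (a : chart A) (b : chart B) : 'rV[R]_m -> 'rV[R]_n :=
  fun x => coord b (h (param a x)).

Definition rep_dom (R : realType) (m n : nat) (S T : Type)
    (A : atlas R m S) (B : atlas R n T) (h : S -> T)
    (a : chart A) (b : chart B) : set 'rV[R]_m :=
  coord a @` (dom a `&` h @^-1` (dom b)).

(* The Jacobian matrix at [coord a p] of h read in the charts a and b.
   Tangent vectors are row vectors, acted upon from the right: row i is the
   image of the i-th coordinate vector. *)
Definition tangent_mx (R : realType) (m n : nat) (S T : Type)
    (A : atlas R m S) (B : atlas R n T) (h : S -> T)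
    (a : chart A) (b : chart B) (p : S) : 'M[R]_(m, n) :=
  jacobian (rep h a b) (coord a p).

Definition is_chart (R : realType) (n : nat) (T : topologicalType)
    (A : atlas R n T) (a : chart A) : Prop :=
  [/\ open (dom a),
      open (coord a @` dom a),
      (forall p, dom a p -> param a (coord a p) = p),
      (forall p, dom a p -> {for p, continuous (coord a)}) &
      (forall x, (coord a @` dom a) x -> {for x, continuous (param a)})].

Definition smooth_manifold (R : realType) (n : nat) (T : topologicalType)
    (A : atlas R n T) : Prop :=
  [/\ hausdorff_space T,
      @second_countable T,
      (forall p, exists a : chart A, dom a p),
      (forall a : chart A, is_chart a) &
      (forall a b : chart A, smooth_on (rep_dom id a b) (rep id a b))].

Definition smooth_map (R : realType) (m n : nat) (S T : topologicalType)
    (A : atlas R m S) (B : atlas R n T) (h : S -> T) : Prop :=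
  [/\ continuous h,
      (forall p, exists b : chart B, dom b (h p)) &
      (forall (a : chart A) (b : chart B),
         smooth_on (rep_dom h a b) (rep h a b))].

(* A covariant 2-tensor field, given by its component matrices in each chart as
   functions of the coordinates. *)
Definition tensor2 (R : realType) (n : nat) (T : Type) (A : atlas R n T) : Type :=
  chart A -> 'rV[R]_n -> 'M[R]_n.

Definition inner (R : realType) (n : nat) (T : Type) (A : atlas R n T)
    (g : tensor2 A) (a : chart A) (p : T) (u v : 'rV[R]_n) : R :=
  (u *m g a (coord a p) *m v^T) 0 0.

Definition is_pullback (R : realType) (m n : nat) (S T : Type)
    (A : atlas R m S) (B : atlas R n T) (h : S -> T)
    (gA : tensor2 A) (gB : tensor2 B) : Prop :=
  forall (a : chart A) (b : chart B) (p : S), dom a p -> dom b (h p) ->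
    gA a (coord a p) =
    tangent_mx h a b p *m gB b (coord b (h p)) *m (tangent_mx h a b p)^T.

(* The first condition is the transformation law under changes of charts. *)
Definition riemannian_metric (R : realType) (n : nat) (T : Type)
    (A : atlas R n T) (g : tensor2 A) : Prop :=
  [/\ is_pullback id g g,
      (forall a : chart A, smooth_on (coord a @` dom a) (g a)),
      (forall (a : chart A) (p : T) (u v : 'rV[R]_n), dom a p ->
         inner g a p u v = inner g a p v u) &
      (forall (a : chart A) (p : T) (u : 'rV[R]_n), dom a p ->
         u != 0 -> 0 < inner g a p u u)].

Definition partial (R : realType) (n : nat) (i : 'I_n) (u : 'rV[R]_n -> R)
    (x : 'rV[R]_n) : R :=
  'D_(delta_mx 0 i) u x.

(* Gamma^k_ij of the Levi-Civita connection of the metric with components G. *)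
Definition christoffel (R : realType) (n : nat) (G : 'rV[R]_n -> 'M[R]_n)
    (k i j : 'I_n) (x : 'rV[R]_n) : R :=
  2^-1 * \sum_(l < n) invmx (G x) k l *
    (partial i (fun y => G y j l) x + partial j (fun y => G y i l) x
     - partial l (fun y => G y i j) x).

(* R(d_i, d_j) d_k = \sum_l (riemann G l k i j) d_l, where
   R(X, Y) = [nabla_X, nabla_Y] - nabla_[X, Y]. *)
Definition riemann (R : realType) (n : nat) (G : 'rV[R]_n -> 'M[R]_n)
    (l k i j : 'I_n) (x : 'rV[R]_n) : R :=
  partial i (christoffel G l j k) x - partial j (christoffel G l i k) x
  + \sum_(r < n) (christoffel G l i r x * christoffel G r j k x
                  - christoffel G l j r x * christoffel G r i k x).

(* Ric(Y, Z) = trace (X |-> R(X, Y) Z). *)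
Definition ricci (R : realType) (n : nat) (G : 'rV[R]_n -> 'M[R]_n)
    (x : 'rV[R]_n) : 'M[R]_n :=
  \matrix_(j, k) \sum_(i < n) riemann G i k i j x.

Definition timelike_convergence (R : realType) (n : nat) (T : Type)
    (A : atlas R n T) (g : tensor2 A) : Prop :=
  forall (a : chart A) (p : T), dom a p ->
  forall z : 'rV[R]_n, inner g a p z z < 0 ->
    0 <= inner (fun b : chart A => ricci (g b)) a p z z.

Definition hessian (R : realType) (n : nat) (G : 'rV[R]_n -> 'M[R]_n)
    (u : 'rV[R]_n -> R) (x : 'rV[R]_n) : 'M[R]_n :=
  \matrix_(i, j) (partial i (partial j u) x
                  - \sum_(k < n) christoffel G k i j x * partial k u x).

Definition laplacian (R : realType) (n : nat) (T : Type) (A : atlas R n T)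
    (g : tensor2 A) (a : chart A) (u : T -> R) (p : T) : R :=
  \tr (invmx (g a (coord a p)) *m
       hessian (g a) (fun x => u (param a x)) (coord a p)).

(* Spacelike: the induced metric gM is Riemannian. *)
Definition spacelike_immersion (R : realType) (m n : nat)
    (S T : topologicalType) (A : atlas R m S) (B : atlas R n T) (psi : S -> T)
    (gM : tensor2 A) (g : tensor2 B) : Prop :=
  [/\ smooth_map A B psi,
      (forall (a : chart A) (b : chart B) (p : S), dom a p -> dom b (psi p) ->
         row_free (tangent_mx psi a b p)),
      is_pullback psi gM g &
      riemannian_metric gM].

(* [N b p] is the row of components of the tangent vector N(p) at [psi p] in the
   chart b. *)
Definition vector_field_along (R : realType) (m n : nat) (S T : Type)
    (A : atlas R m S) (B : atlas R n T) (psi : S -> T)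
    (N : chart B -> S -> 'rV[R]_n) : Prop :=
  (forall (b b' : chart B) (p : S), dom b (psi p) -> dom b' (psi p) ->
     N b' p = N b p *m tangent_mx id b b' (psi p)) /\
  (forall (a : chart A) (b : chart B),
     smooth_on (rep_dom psi a b) (fun x => N b (param a x))).

Definition unit_timelike_normal (R : realType) (m n : nat) (S T : Type)
    (A : atlas R m S) (B : atlas R n T) (psi : S -> T) (g : tensor2 B)
    (N : chart B -> S -> 'rV[R]_n) : Prop :=
  forall (a : chart A) (b : chart B) (p : S), dom a p -> dom b (psi p) ->
    inner g b (psi p) (N b p) (N b p) = -1 /\
    (forall v : 'rV[R]_m,
       inner g b (psi p) (v *m tangent_mx psi a b p) (N b p) = 0).

(* Row i is the covariant derivative of N along psi in the direction d_i. *)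
Definition covariant_derivative (R : realType) (m n : nat) (S T : Type)
    (A : atlas R m S) (B : atlas R n T) (psi : S -> T) (g : tensor2 B)
    (N : chart B -> S -> 'rV[R]_n) (a : chart A) (b : chart B) (p : S)
    : 'M[R]_(m, n) :=
  \matrix_(i, k)
    (partial i (fun x => N b (param a x) 0 k) (coord a p)
     + \sum_(r < n) \sum_(s < n) christoffel (g b) k r s (coord b (psi p))
         * tangent_mx psi a b p i r * N b p 0 s).

(* The matrix S with S *m tangent_mx psi a b p = - nabla N: its row i holds the
   components of A d_i = - nabla_{d_i} N (which is tangent to the hypersurface)
   in the basis of the images of the coordinate vectors. *)
Definition shape_operator (R : realType) (m n : nat) (S T : Type)
    (A : atlas R m S) (B : atlas R n T) (psi : S -> T) (g : tensor2 B)
    (N : chart B -> S -> 'rV[R]_n) (a : chart A) (b : chart B) (p : S)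
    : 'M[R]_m :=
  - covariant_derivative psi g N a b p *m pinvmx (tangent_mx psi a b p).

Definition mean_curvature (R : realType) (m n : nat) (S T : Type)
    (A : atlas R m S) (B : atlas R n T) (psi : S -> T) (g : tensor2 B)
    (N : chart B -> S -> 'rV[R]_n) (a : chart A) (b : chart B) (p : S) : R :=
  - (m%:R^-1 * \tr (shape_operator psi g N a b p)).

(* I x F, as the union of the domains of the product charts in R * F. *)
Definition warped_atlas (R : realType) (n : nat) (F : Type) (I : set R)
    (A : atlas R n F) : atlas R (1 + n) (R * F) :=
  {| chart := chart A;
     dom := fun c => I `*` dom c;
     coord := fun c q => row_mx (q.1)%:M (coord c q.2);
     param := fun c x => (lsubmx x 0 0, param c (rsubmx x)) |}.

Definition warped_metric (R : realType) (n : nat) (F : Type) (I : set R)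
    (f : R -> R) (A : atlas R n F) (gF : tensor2 A)
    : tensor2 (warped_atlas I A) :=
  fun (c : chart A) (x : 'rV[R]_(1 + n)) =>
    block_mx (-1)%:M 0
             0       (f (lsubmx x 0 0) ^+ 2 *: gF c (rsubmx x)).

Arguments warped_metric {R n F} I f {A} gF.

(* The components of d/dt in every product chart. *)
Definition dt (R : realType) (n : nat) : 'rV[R]_(1 + n) := row_mx 1%:M 0.

(* Main.v *)
(* In coordinates, let u = g(N, d/dt) = cosh phi, let h = f'/f at the time function
   tau, let t = d tau, with T its metric dual, and let S be the shape operator.
   Gauss and Weingarten give Hess tau = u S - h (1 + t T) and grad u = T S - h u T, so
   the traced Codazzi equation (tr S being constant) expresses Delta u through
   Ric(N, N), tr S and tr S^2. Since |T|^2 = u^2 - 1 = sinh^2 phi, one finds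
     u Delta u - RHS = |Hess tau|^2 + u^2 (Ric(N, N) + n k - (u^2 - 1) k),  k = f''/f.
   The timelike convergence condition at d/dt gives k <= 0, and at timelike vectors
   N + mu d/dt tending to a null vector it gives Ric(N, N) + n k >= 0. The only
   Ricci components computed are those of d/dt: as f d/dt is closed and conformal,
   Ric(d/dt, .) = - n k dt. *)
Require Import Defs.
From HB Require Import structures.
From mathcomp Require Import all_boot all_order all_algebra.
From mathcomp Require Import all_classical all_reals all_analysis.
From mathcomp Require Import ring lra.

Set Implicit Arguments.
Unset Strict Implicit.
Unset Printing Implicit Defensive.

Import Order.TTheory GRing.Theory Num.Theory.
Import numFieldNormedType.Exports.

Local Open Scope classical_set_scope.
Local Open Scope ring_scope.

(** * Functions of class C^k *)

(** The right-hand side hides a cancellation: the term n^2 H^2 sinh^2 phi / 4 of its first square is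
    removed by the second summand, so it is only linear in H. Hence no inequality between tr S^2 and
    (tr S)^2 is used: tr S^2 stays inside |Hess tau|^2, of which only the sign matters. For the
    curvature, the convergence condition at N alone gives Ric(N, N) >= 0, which is too weak because
    n k <= 0; this is what forces the limit along combinations N + mu d/dt. The computation stays in
    coordinate frames. The shape operator is differentiated as a family of row vectors, with only
    one of its indices corrected by Christoffel symbols. The omitted terms are not tensorial, but
    those of the Codazzi equation match those of the divergence of T S, so covariant derivatives of
    (1,1)-tensors are avoided. In such frames S and the Hessian operator are self-adjoint for g
    instead of symmetric matrices, so the sign of the trace of a square is read off after a change
    of basis that turns g into the identity. *)

Section Ck.
Context {R : realType}.
Implicit Types V W X : normedModType R.

(** The induction steps for products, inverses and compositions keep undifferentiated factors, which
    are then needed with one order of regularity less. *)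
Lemma Ck_onW V W k (U : set V) (f : V -> W) : Ck_on k.+1 U f -> Ck_on k U f.
Proof.
elim: k f => [|k IH] f [df dDf].
  by move=> x /df /differentiable_continuous.
by split=> // v; apply: IH (dDf v).
Qed.

Lemma near_open V (U : set V) (P : V -> Prop) x :
  open U -> U x -> (forall y, U y -> P y) -> \forall y \near x, P y.
Proof. by move=> oU Ux UP; apply: (filterS UP); apply: open_nbhs_nbhs. Qed.

Lemma eq_on_derive V W (U : set V) (f g : V -> W) v x : open U ->
  (forall y, U y -> f y = g y) -> U x -> 'D_v f x = 'D_v g x.
Proof. by move=> oU fg Ux; apply: near_eq_derive; apply: near_open fg. Qed.

(** The first-order expansion of [f] at [x] is also one of [g], so both have the same differential.
    Most identities below hold only on an open set, which makes such local transfers necessary. *)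
Lemma near_eq_differentiable V W (f g : V -> W) x :
  (\near x, f x = g x) -> differentiable f x -> differentiable g x.
Proof.
move=> fg /diff_locallyP [cf df].
have fgx : f x = g x by exact: nbhs_singleton fg.
have E : g \o shift x = cst (g x) + 'd f x +o_ (0 : V) id.
  move: df => /eqaddoP df; apply/eqaddoP => e e0.
  move: fg; rewrite (near_shift 0 x) subr0 => fg.
  by apply: filterS2 fg (df e e0) => y /=; rewrite !fctE /= fgx => ->.
have dE : 'd g x = 'd f x :> (V -> W) by exact: diff_unique cf E.
by apply/diff_locallyP; rewrite dE.
Qed.

Lemma eq_on_differentiable V W (U : set V) (f g : V -> W) x : open U ->
  (forall y, U y -> f y = g y) -> U x ->
  differentiable f x -> differentiable g x.
Proof.
by move=> oU fg Ux; apply: near_eq_differentiable; apply: near_open fg.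
Qed.

Lemma Ck_on_eq V W k (U : set V) (f g : V -> W) : open U ->
  (forall x, U x -> f x = g x) -> Ck_on k U f -> Ck_on k U g.
Proof.
move=> oU; elim: k f g => [|k IH] f g fg /=.
  move=> cf x Ux; change (g @ x --> g x); rewrite -(fg x Ux).
  by apply: cvg_trans (cf x Ux); apply: near_eq_cvg; apply: near_open fg.
case=> df Df; split=> [x Ux|v].
  by apply: (eq_on_differentiable oU fg Ux); exact: df.
by apply: IH (Df v) => x Ux; exact: eq_on_derive fg Ux.
Qed.

Lemma Ck_on_cst V W k (U : set V) (c : W) : Ck_on k U (fun _ : V => c).
Proof.
elim: k c => [|k IH] c /=; first by move=> x _; exact: cst_continuous.
split=> [x _|v]; first exact: differentiable_cst.
suff -> : 'D_v (fun _ : V => c) = (fun=> 0) by exact: IH.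
by apply/funext => x; exact: derive_cst.
Qed.

Lemma Ck_onD V W k (U : set V) (f g : V -> W) : open U ->
  Ck_on k U f -> Ck_on k U g -> Ck_on k U (fun x => f x + g x).
Proof.
move=> oU; elim: k f g => [|k IH] f g /=.
  by move=> cf cg x Ux; apply: continuousD; [exact: cf|exact: cg].
move=> [df Df] [dg Dg]; split=> [x Ux|v].
  by apply: differentiableD; [exact: df|exact: dg].
apply: Ck_on_eq (IH _ _ (Df v) (Dg v)) => // x Ux.
by rewrite [RHS]deriveD //; apply: diff_derivable; [exact: df|exact: dg].
Qed.

Lemma derive_mul V (f g : V -> R) x v :
  differentiable f x -> differentiable g x ->
  'D_v (fun y => f y * g y) x = 'D_v f x * g x + f x * 'D_v g x.
Proof.
move=> df dg; rewrite [LHS]deriveM; try exact: diff_derivable.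
by rewrite addrC /GRing.scale /= mulrC.
Qed.

Lemma Ck_onM V k (U : set V) (f g : V -> R) : open U ->
  Ck_on k U f -> Ck_on k U g -> Ck_on k U (fun x => f x * g x).
Proof.
move=> oU; elim: k f g => [|k IH] f g.
  by move=> cf cg x Ux; apply: continuousM; [exact: cf|exact: cg].
move=> Cf Cg; have := (Ck_onW Cf, Ck_onW Cg); case: Cf Cg => [df Df] [dg Dg].
move=> [Cf Cg]; split=> [x Ux|v].
  by apply: differentiableM; [exact: df|exact: dg].
have := Ck_onD oU (IH _ _ (Df v) Cg) (IH _ _ Cf (Dg v)).
apply: Ck_on_eq => // x Ux; rewrite derive_mul //; [exact: df|exact: dg].
Qed.

Lemma derive_inv V (f : V -> R) x v : differentiable f x -> f x != 0 ->
  'D_v (fun y => (f y)^-1) x = - ('D_v f x * ((f x)^-1 * (f x)^-1)).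
Proof.
move=> df f0; rewrite deriveE; last exact: differentiableV.
by rewrite diffV //= -deriveE // /GRing.scale /= mulNr mulrC expr2 invfM.
Qed.

Lemma Ck_onV V k (U : set V) (f : V -> R) : open U ->
  (forall x, U x -> f x != 0) -> Ck_on k U f -> Ck_on k U (fun x => (f x)^-1).
Proof.
move=> oU f0; elim: k => [|k IH].
  by move=> cf x Ux; apply: continuousV; [exact: f0|exact: cf].
move=> Cf; have Cf' := IH (Ck_onW Cf); case: Cf => [df Df].
split=> [x Ux|v]; first by apply: differentiableV; [exact: df|exact: f0].
have := Ck_onM oU (@Ck_on_cst V R k U (-1)) (Ck_onM oU (Df v) (Ck_onM oU Cf' Cf')).
by apply: Ck_on_eq => // x Ux; rewrite derive_inv ?mulN1r //; [exact: df|exact: f0].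
Qed.

(* The difference quotients of [f \o L] are those of [f] in direction [L v]. *)
Lemma derive_comp_linear V W X (L : {linear V -> W}) (f : W -> X) x v :
  'D_v (f \o L) x = 'D_(L v) f (L x).
Proof.
by rewrite /derive; under eq_fun do rewrite /= linearP.
Qed.

Lemma Ck_on_comp_linear V W X k (L : {linear V -> W}) (Om : set W) (U : set V)
    (f : W -> X) : continuous L -> (forall x, U x -> Om (L x)) ->
  Ck_on k Om f -> Ck_on k U (f \o L).
Proof.
move=> cL UOm; elim: k f => [|k IH] f.
  by move=> cf x Ux; apply: continuous_comp; [exact: cL|apply: cf; exact: UOm].
case=> df Df; split=> [x Ux|v].
  by apply: differentiable_comp; [exact: linear_differentiable|apply: df; exact: UOm].
suff -> : 'D_v (f \o L) = 'D_(L v) f \o L by exact: IH (Df _).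
by apply/funext => x; rewrite derive_comp_linear.
Qed.

Lemma derive_entry V m n (f : V -> 'M[R]_(m, n)) i j x v :
  differentiable f x -> 'D_v (fun y => f y i j) x = 'D_v f x i j.
Proof. by move=> df; rewrite derive_mx ?mxE //; exact: diff_derivable. Qed.

Lemma Ck_on_entry V m n k (U : set V) (f : V -> 'M[R]_(m, n)) i j : open U ->
  Ck_on k U f -> Ck_on k U (fun x => f x i j).
Proof.
move=> oU; elim: k f => [|k IH] f.
  move=> cf x Ux.
  apply: (@continuous_comp _ _ _ f (fun A : 'M[R]_(m, n) => A i j) x (cf x Ux)).
  exact: coord_continuous.
case=> df Df; split=> [x Ux|v].
  by apply: (@differentiable_comp _ _ _ _ f (fun A : 'M[R]_(m, n) => A i j) x (df x Ux));
  exact: differentiable_coord.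
by apply: Ck_on_eq (IH _ (Df v)) => // x Ux; rewrite derive_entry //; exact: df.
Qed.

Lemma Ck_on_sum V (J : Type) (r : seq J) (P : pred J) k (U : set V)
    (F : J -> V -> R) : open U -> (forall j, Ck_on k U (F j)) ->
  Ck_on k U (fun x => \sum_(j <- r | P j) F j x).
Proof.
move=> oU CF; elim: r => [|j r IH].
  by apply: Ck_on_eq (Ck_on_cst k U 0) => // x _; rewrite big_nil.
have [Pj|/negbTE Pj] := boolP (P j); last first.
  by apply: Ck_on_eq IH => // x _; rewrite big_cons Pj.
by apply: Ck_on_eq (Ck_onD oU (CF j) IH) => // x _; rewrite big_cons Pj.
Qed.

Lemma Ck_on_prod V (J : Type) (r : seq J) (P : pred J) k (U : set V)
    (F : J -> V -> R) : open U -> (forall j, Ck_on k U (F j)) ->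
  Ck_on k U (fun x => \prod_(j <- r | P j) F j x).
Proof.
move=> oU CF; elim: r => [|j r IH].
  by apply: Ck_on_eq (@Ck_on_cst V R k U 1) => // x _; rewrite big_nil.
have [Pj|/negbTE Pj] := boolP (P j); last first.
  by apply: Ck_on_eq IH => // x _; rewrite big_cons Pj.
by apply: Ck_on_eq (Ck_onM oU (CF j) IH) => // x _; rewrite big_cons Pj.
Qed.

Lemma derive_comp_rV V m (h : 'rV[R]_m -> R) (F : V -> 'rV[R]_m) x v :
  differentiable F x -> differentiable h (F x) ->
  'D_v (h \o F) x =
    \sum_a 'D_v F x 0 a * 'D_(delta_mx 0 a) h (F x).
Proof.
move=> dF dh; rewrite deriveE; last exact: differentiable_comp.
rewrite diff_comp //= -(deriveE v dF) {1}[ 'D_v F x]row_sum_delta linear_sum.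
by apply: eq_bigr => a _; rewrite linearZ /= -deriveE.
Qed.

(** Induction on [k] for all [h] at once: by the chain rule a derivative of [h \o F] is a sum of
    products of entries of a derivative of [F] with compositions of partial derivatives of [h] with
    [F]. *)
Lemma Ck_on_comp_rV V m k (h : 'rV[R]_m -> R) (F : V -> 'rV[R]_m)
    (U : set V) (Om : set 'rV[R]_m) : open U -> (forall x, U x -> Om (F x)) ->
  Ck_on k U F -> Ck_on k Om h -> Ck_on k U (h \o F).
Proof.
move=> oU UOm; elim: k h => [|k IH] h CF.
  by move=> ch x Ux; apply: continuous_comp; [exact: CF|apply: ch; exact: UOm].
have CF' := Ck_onW CF; case: CF => [dF DF] [dh Dh].
split=> [x Ux|v].
  by apply: differentiable_comp; [exact: dF|apply: dh; exact: UOm].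
have : Ck_on k U (fun x =>
    \sum_a 'D_v F x 0 a * ((fun y => 'D_(delta_mx 0 a) h y) \o F) x).
  apply: Ck_on_sum => // a; apply: Ck_onM => //; last exact: IH CF' (Dh _).
  exact: Ck_on_entry (DF v).
apply: Ck_on_eq => // x Ux; rewrite derive_comp_rV //; [exact: dF|].
by apply: dh; exact: UOm.
Qed.

Lemma is_derive_line V (f : V -> R) x v s : derivable f (x + s *: v) v ->
  is_derive s 1 (fun r : R => f (x + r *: v)) ('D_v f (x + s *: v)).
Proof.
have E : (fun h : R => h^-1 *: (((fun r : R => f (x + r *: v)) \o shift s) (h *: 1)
           - f (x + s *: v))) =
         (fun h : R => h^-1 *: ((f \o shift (x + s *: v)) (h *: v) - f (x + s *: v))).
  apply/funext => h /=; congr (_ *: (f _ - _)).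
  by rewrite [h *: 1]mulr1 scalerDl addrCA.
by move=> df; split; rewrite /derivable /derive E.
Qed.

Lemma MVT_line V (f : V -> R) x v (e : R) : 0 < e ->
  (forall s, 0 <= s <= e -> derivable f (x + s *: v) v) ->
  exists2 c, 0 <= c <= e & f (x + e *: v) - f x = e * 'D_v f (x + c *: v).
Proof.
move=> e0 df; pose g (r : R) := f (x + r *: v).
have dg s : s \in `[0, e]%R -> is_derive s 1 g ('D_v f (x + s *: v)).
  by rewrite in_itv /= => /df; exact: is_derive_line.
pose dgf (s : R) : R := 'D_v f (x + s *: v).
have cg : {within `[0, e], continuous g}.
  by apply: derivable_within_continuous => s /dg [].
have dg' s : s \in `]0, e[%R -> is_derive s 1 g (dgf s).
  by rewrite in_itv /= => /andP[s0 se]; apply: dg; rewrite in_itv /= !ltW.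
have [c] := MVT_segment (ltW e0) dg' cg.
rewrite in_itv /= => ce; rewrite /g /dgf scale0r addr0 subr0 mulrC => E.
by exists c.
Qed.

Lemma derive_shift_point V (f : V -> R) a x v :
  'D_v (fun y => f (y + a)) x = 'D_v f (x + a).
Proof.
by rewrite /derive; under eq_fun do rewrite /= -addrA.
Qed.

Lemma derivable_shift_point V (f : V -> R) a x v :
  derivable f (x + a) v -> derivable (fun y => f (y + a)) x v.
Proof.
rewrite /derivable => df; suff -> : (fun h : R => h^-1 *:
    (((fun y => f (y + a)) \o shift x) (h *: v) - f (x + a))) =
  (fun h => h^-1 *: ((f \o shift (x + a)) (h *: v) - f (x + a))) by [].
by apply/funext => h /=; rewrite addrA.
Qed.

(** The mean value theorem in direction [v] for the increment of [f] across [e *: w], then in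
    direction [w] for ['D_v f]. *)
Lemma MVT_parallelogram V (U : set V) (f : V -> R) x v w (e : R) : 0 < e ->
  Ck_on 2 U f ->
  (forall s t, 0 <= s <= e -> 0 <= t <= e -> U (x + s *: v + t *: w)) ->
  exists c d, [/\ 0 <= c <= e, 0 <= d <= e &
    f (x + e *: v + e *: w) - f (x + e *: v) - (f (x + e *: w) - f x) =
    e * (e * 'D_w ('D_v f) (x + c *: v + d *: w))].
Proof.
move=> e0 [df Df] UB; have [dDf _] := Df v.
have ee : 0 <= e <= e by rewrite ltW /=.
have e00 : 0 <= (0 : R) <= e by apply/andP; split=> //; exact: ltW.
have UB0 s : 0 <= s <= e -> U (x + s *: v).
  by move=> /UB -/(_ 0 e00); rewrite scale0r addr0.
pose g y := f (y + e *: w) - f y.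
have dg1 s : 0 <= s <= e -> derivable (fun y => f (y + e *: w)) (x + s *: v) v.
  by move=> se; apply/derivable_shift_point/diff_derivable/df; exact: UB.
have dg2 s : 0 <= s <= e -> derivable f (x + s *: v) v.
  by move=> se; apply/diff_derivable/df/UB0.
have [|c ce Ec] := @MVT_line _ g x v e e0.
  by move=> s se; apply: derivableB; [exact: dg1|exact: dg2].
have [|d de Ed] := @MVT_line _ ('D_v f) (x + c *: v) w e e0.
  by move=> s se; apply/diff_derivable/dDf/UB.
exists c, d; split=> //.
by rewrite -Ed -[LHS]/(g (x + e *: v) - g x) Ec /g deriveB ?derive_shift_point //;
  [exact: dg1|exact: dg2].
Qed.

(** The second difference over a parallelogram is symmetric in [v] and [w], so the two mixed
    derivatives take a common value at points arbitrarily close to [x], and continuity concludes.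
    All commutation identities for connections and curvature rest on this. *)
Lemma derive_comm V (U : set V) (f : V -> R) x v w : open U ->
  Ck_on 2 U f -> U x -> 'D_v ('D_w f) x = 'D_w ('D_v f) x.
Proof.
move=> oU Cf Ux; pose A := 'D_w ('D_v f); pose B := 'D_v ('D_w f).
have cA : {for x, continuous A} by case: Cf => _ /(_ v) [_ /(_ w)] /(_ x Ux).
have cB : {for x, continuous B} by case: Cf => _ /(_ w) [_ /(_ v)] /(_ x Ux).
have key (e : R) : 0 < e ->
    (forall s t, 0 <= s <= e -> 0 <= t <= e -> U (x + s *: v + t *: w)) ->
    exists c d c' d', [/\ 0 <= c <= e, 0 <= d <= e, 0 <= c' <= e, 0 <= d' <= e &
      A (x + c *: v + d *: w) = B (x + c' *: v + d' *: w)].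
  move=> e0 UB.
  have [c [d [ce de Ecd]]] := @MVT_parallelogram V U f x v w e e0 Cf UB.
  have [|d' [c' [de' ce' Ecd']]] := @MVT_parallelogram V U f x w v e e0 Cf.
    by move=> s t se te; rewrite addrAC; exact: UB.
  exists c, d, c', d'; split; [exact: ce|exact: de|exact: ce'|exact: de'|].
  apply: (mulfI (lt0r_neq0 e0)); apply: (mulfI (lt0r_neq0 e0)).
  apply: etrans (esym Ecd) _; rewrite [x + c' *: v + _]addrAC; apply: etrans _ Ecd'.
  by rewrite [x + e *: w + e *: v]addrAC; ring.
suff : B x = A x by [].
clearbody A B.
apply/eqP; rewrite -subr_eq0 -normr_le0; apply/ler_addgt0Pr => eps eps0.
rewrite add0r.
have eps2 : 0 < eps / 2 by rewrite divr_gt0.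
have : \forall y \near x, [/\ U y, `|A x - A y| < eps / 2 & `|B x - B y| < eps / 2].
  have nA : \forall y \near x, `|A x - A y| < eps / 2.
    by move/cvgrPdist_lt : cA; apply.
  have nB : \forall y \near x, `|B x - B y| < eps / 2.
    by move/cvgrPdist_lt : cB; apply.
  by apply: filterS3 (open_nbhs_nbhs (conj oU Ux)) nA nB.
move=> /nbhs_ballP [r /= r0 xr].
(* Points of the parallelogram lie within [e * (K - 1)] of [x]; the summand 1 keeps [K] positive
   even if both directions vanish. *)
pose K := `|v| + `|w| + 1.
have K0 : 0 < K by rewrite ltr_wpDl // addr_ge0.
pose e := r / K / 2.
have e0 : 0 < e by rewrite !divr_gt0.
have near_x s t : 0 <= s <= e -> 0 <= t <= e -> ball x r (x + s *: v + t *: w).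
  move=> /andP[s0 se] /andP[t0 te]; rewrite -ball_normE /= -addrA opprD addNKr normrN.
  rewrite (le_lt_trans (ler_normD _ _)) // !normrZ !ger0_norm //.
  have : e * K < r.
    by rewrite /e mulrAC divfK ?gt_eqF // ltr_pdivrMr // ltr_pMr // ltr1n.
  apply: le_lt_trans; rewrite /K !mulrDr mulr1.
  by rewrite ler_wpDr ?(ltW e0) // lerD // ler_wpM2r.
have [|c [d [c' [d' [ce de ce' de' AB]]]]] := key e e0.
  by move=> s t se te; have [] := xr _ (near_x s t se te).
have [_ hA _] := xr _ (near_x c d ce de).
have [_ _ hB] := xr _ (near_x c' d' ce' de').
rewrite -AB in hB; rewrite ltW //.
have -> : B x - A x = (B x - A (x + c *: v + d *: w)) - (A x - A (x + c *: v + d *: w)).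
  by ring.
by rewrite (splitr eps) (le_lt_trans (ler_normB _ _)) // ltrD.
Qed.
End Ck.

(** * Smooth scalar functions *)

Section smooth_scalar.
Context {R : realType} {V : normedModType R}.
Implicit Types (U : set V) (f g : V -> R).

Lemma smooth_on_diff U f x : smooth_on U f -> U x -> differentiable f x.
Proof. by move=> /(_ 1%N) [df _]; exact: df. Qed.

Lemma smooth_on_derive U f v : smooth_on U f -> smooth_on U ('D_v f).
Proof. by move=> sf k; have [_] := sf k.+1; apply. Qed.

Lemma smooth_on_eq U f g : open U -> (forall x, U x -> f x = g x) ->
  smooth_on U f -> smooth_on U g.
Proof. by move=> oU fg sf k; exact: Ck_on_eq (sf k). Qed.

Lemma smooth_on_cst U (c : R) : smooth_on U (fun _ : V => c).
Proof. by move=> k; exact: Ck_on_cst. Qed.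

Lemma smooth_onD U f g : open U -> smooth_on U f -> smooth_on U g ->
  smooth_on U (fun x => f x + g x).
Proof. by move=> oU sf sg k; apply: Ck_onD. Qed.

Lemma smooth_onM U f g : open U -> smooth_on U f -> smooth_on U g ->
  smooth_on U (fun x => f x * g x).
Proof. by move=> oU sf sg k; apply: Ck_onM. Qed.

Lemma smooth_onV U f : open U -> (forall x, U x -> f x != 0) ->
  smooth_on U f -> smooth_on U (fun x => (f x)^-1).
Proof. by move=> oU f0 sf k; apply: Ck_onV. Qed.

Lemma smooth_on_sum U (J : Type) (r : seq J) (P : pred J) (F : J -> V -> R) :
  open U -> (forall j, smooth_on U (F j)) ->
  smooth_on U (fun x => \sum_(j <- r | P j) F j x).
Proof. by move=> oU sF k; apply: Ck_on_sum => // j; exact: sF. Qed.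

Lemma smooth_on_prod U (J : Type) (r : seq J) (P : pred J) (F : J -> V -> R) :
  open U -> (forall j, smooth_on U (F j)) ->
  smooth_on U (fun x => \prod_(j <- r | P j) F j x).
Proof. by move=> oU sF k; apply: Ck_on_prod => // j; exact: sF. Qed.

Lemma smooth_on_det n U (A : V -> 'M[R]_n) : open U ->
  (forall i j, smooth_on U (fun x => A x i j)) ->
  smooth_on U (fun x => \det (A x)).
Proof.
move=> oU sA; rewrite /determinant; apply: smooth_on_sum => // s.
by apply: smooth_onM; [|exact: smooth_on_cst|exact: smooth_on_prod].
Qed.

Lemma derive_add f g x v : differentiable f x -> differentiable g x ->
  'D_v (fun y => f y + g y) x = 'D_v f x + 'D_v g x.
Proof. by move=> df dg; rewrite [LHS]deriveD //; exact: diff_derivable. Qed.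

Lemma derive_bigsum (J : Type) (r : seq J) (F : J -> V -> R) x v :
  (forall j, differentiable (F j) x) ->
  differentiable (fun y => \sum_(j <- r) F j y) x /\
  'D_v (fun y => \sum_(j <- r) F j y) x = \sum_(j <- r) 'D_v (F j) x.
Proof.
move=> dF; elim: r => [|j r [dr IH]].
  have -> : (fun y => \sum_(j <- [::]) F j y) = (fun=> 0).
    by apply/funext => y; rewrite big_nil.
  by rewrite big_nil; split; [exact: differentiable_cst|exact: derive_cst].
have -> : (fun y => \sum_(i <- j :: r) F i y) =
    (fun y => F j y + \sum_(i <- r) F i y).
  by apply/funext => y; rewrite big_cons.
by rewrite big_cons -IH derive_add //; split=> //; apply: differentiableD.
Qed.
End smooth_scalar.

(* Locked: unification would otherwise unfold the underlying limits. *)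
HB.lock Definition partial_mx (R : realType) (n p q : nat) (i : 'I_n)
    (A : 'rV[R]_n -> 'M[R]_(p, q)) (x : 'rV[R]_n) : 'M[R]_(p, q) :=
  \matrix_(j, k) partial i (fun y => A y j k) x.

(** * Smooth matrix-valued functions and their partial derivatives *)

Section smooth_matrix.
Context {R : realType} {n : nat}.
Implicit Types (U : set 'rV[R]_n) (x : 'rV[R]_n) (i : 'I_n).

Definition smooth_mx p q U (A : 'rV[R]_n -> 'M[R]_(p, q)) : Prop :=
  forall j k, smooth_on U (fun x => A x j k).

Lemma partial_mxE p q i (A : 'rV[R]_n -> 'M[R]_(p, q)) x j k :
  partial_mx i A x j k = partial i (fun y => A y j k) x.
Proof. by rewrite unlock mxE. Qed.

Lemma partial_eq U i f g x : open U -> (forall y, U y -> f y = g y) -> U x ->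
  partial i f x = partial i g x.
Proof. exact: eq_on_derive. Qed.

Lemma smooth_mx_eq U p q (A B : 'rV[R]_n -> 'M[R]_(p, q)) : open U ->
  (forall x, U x -> A x = B x) -> smooth_mx U A -> smooth_mx U B.
Proof.
by move=> oU AB sA j k; apply: smooth_on_eq (sA j k) => // x Ux; rewrite AB.
Qed.

Lemma smooth_mx_of U p q (A : 'rV[R]_n -> 'M[R]_(p, q)) : open U ->
  smooth_on U A -> smooth_mx U A.
Proof. by move=> oU sA i j k; exact: Ck_on_entry. Qed.

Lemma smooth_mx_diff U p q (A : 'rV[R]_n -> 'M[R]_(p, q)) j k x :
  smooth_mx U A -> U x -> differentiable (fun y => A y j k) x.
Proof. by move=> sA; exact: smooth_on_diff. Qed.

Lemma smooth_mx_cst U p q (A : 'M[R]_(p, q)) : smooth_mx U (fun _ => A).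
Proof. by move=> j k; exact: smooth_on_cst. Qed.

Lemma smooth_mxD U p q (A B : 'rV[R]_n -> 'M[R]_(p, q)) : open U ->
  smooth_mx U A -> smooth_mx U B -> smooth_mx U (fun x => A x + B x).
Proof.
move=> oU sA sB j k; apply: smooth_on_eq (smooth_onD oU (sA j k) (sB j k)) => //.
by move=> x _; rewrite mxE.
Qed.

Lemma smooth_mxZ U p q (a : 'rV[R]_n -> R) (A : 'rV[R]_n -> 'M[R]_(p, q)) :
  open U -> smooth_on U a -> smooth_mx U A -> smooth_mx U (fun x => a x *: A x).
Proof.
move=> oU sa sA j k; apply: smooth_on_eq (smooth_onM oU sa (sA j k)) => //.
by move=> x _; rewrite mxE.
Qed.

Lemma smooth_mxN U p q (A : 'rV[R]_n -> 'M[R]_(p, q)) : open U ->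
  smooth_mx U A -> smooth_mx U (fun x => - A x).
Proof.
move=> oU sA; apply: smooth_mx_eq (smooth_mxZ oU (@smooth_on_cst _ _ U (-1)) sA) => //.
by move=> x _; rewrite scaleN1r.
Qed.

Lemma smooth_mxM U p q r (A : 'rV[R]_n -> 'M[R]_(p, q))
    (B : 'rV[R]_n -> 'M[R]_(q, r)) : open U ->
  smooth_mx U A -> smooth_mx U B -> smooth_mx U (fun x => A x *m B x).
Proof.
move=> oU sA sB j k.
apply: (@smooth_on_eq _ _ U (fun x => \sum_l A x j l * B x l k)) => //.
  by move=> x _; rewrite mxE.
by apply: smooth_on_sum => // l; exact: smooth_onM.
Qed.

Lemma smooth_mxT U p q (A : 'rV[R]_n -> 'M[R]_(p, q)) : open U ->
  smooth_mx U A -> smooth_mx U (fun x => (A x)^T).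
Proof.
by move=> oU sA j k; apply: smooth_on_eq (sA k j) => // x _; rewrite mxE.
Qed.

Lemma smooth_mx_row U p q (A : 'rV[R]_n -> 'M[R]_(p, q)) j : open U ->
  smooth_mx U A -> smooth_mx U (fun x => row j (A x)).
Proof.
by move=> oU sA i k; apply: smooth_on_eq (sA j k) => // x _; rewrite mxE.
Qed.

Lemma smooth_mx_sum U p q (J : Type) (r : seq J) (P : pred J)
    (A : J -> 'rV[R]_n -> 'M[R]_(p, q)) : open U ->
  (forall j, smooth_mx U (A j)) ->
  smooth_mx U (fun x => \sum_(j <- r | P j) A j x).
Proof.
move=> oU sA i k.
apply: (@smooth_on_eq _ _ U (fun x => \sum_(j <- r | P j) A j x i k)) => //.
  by move=> x _; rewrite summxE.
by apply: smooth_on_sum => // l; exact: sA.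
Qed.

(** By Cramer's rule the entries of the inverse are cofactors, polynomial in the entries of [A],
    divided by the determinant. *)
Lemma smooth_mx_invmx U m (A : 'rV[R]_n -> 'M[R]_m) : open U ->
  (forall x, U x -> A x \in unitmx) -> smooth_mx U A ->
  smooth_mx U (fun x => invmx (A x)).
Proof.
move=> oU uA sA j k.
apply: (@smooth_on_eq _ _ U (fun x => (\det (A x))^-1 *
   ((-1) ^+ (k + j) * \det (row' k (col' j (A x)))))) => //.
  by move=> x Ux; rewrite /invmx uA // !mxE.
apply: smooth_onM => //; first apply: smooth_onV => //.
- by move=> x /uA; rewrite unitmxE unitfE.
- exact: smooth_on_det.
- apply: smooth_onM => //; first exact: smooth_on_cst.
  apply: smooth_on_det => // i l; apply: smooth_on_eq (sA (lift k i) (lift j l)) => //.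
  by move=> x _; rewrite !mxE.
Qed.

Lemma smooth_mx_partial U p q i (A : 'rV[R]_n -> 'M[R]_(p, q)) : open U ->
  smooth_mx U A -> smooth_mx U (partial_mx i A).
Proof.
move=> oU sA j k; apply: smooth_on_eq (smooth_on_derive (delta_mx 0 i) (sA j k)) => //.
by move=> x _; rewrite partial_mxE.
Qed.

Lemma partial_mx_eq U p q i (A B : 'rV[R]_n -> 'M[R]_(p, q)) x : open U ->
  (forall y, U y -> A y = B y) -> U x -> partial_mx i A x = partial_mx i B x.
Proof.
move=> oU AB Ux; apply/matrixP => j k; rewrite !(partial_mxE, mxE).
by apply: partial_eq Ux => // y Uy; rewrite AB.
Qed.

Lemma partial_mx_cst p q i (A : 'M[R]_(p, q)) x : partial_mx i (fun _ => A) x = 0.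
Proof. by apply/matrixP => j k; rewrite !(partial_mxE, mxE); exact: derive_cst. Qed.

Lemma partial_mxD U p q i (A B : 'rV[R]_n -> 'M[R]_(p, q)) x :
  smooth_mx U A -> smooth_mx U B -> U x ->
  partial_mx i (fun y => A y + B y) x = partial_mx i A x + partial_mx i B x.
Proof.
move=> sA sB Ux; apply/matrixP => j k; rewrite !(partial_mxE, mxE) /partial.
under eq_fun do rewrite mxE.
by rewrite derive_add //; [exact: smooth_mx_diff sA Ux|exact: smooth_mx_diff sB Ux].
Qed.

Lemma partial_mxZ U p q i (a : 'rV[R]_n -> R) (A : 'rV[R]_n -> 'M[R]_(p, q)) x :
  smooth_on U a -> smooth_mx U A -> U x ->
  partial_mx i (fun y => a y *: A y) x =
    partial i a x *: A x + a x *: partial_mx i A x.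
Proof.
move=> sa sA Ux; apply/matrixP => j k; rewrite !(partial_mxE, mxE) /partial.
under eq_fun do rewrite mxE.
by rewrite derive_mul //; [exact: smooth_on_diff sa Ux|exact: smooth_mx_diff sA Ux].
Qed.

Lemma partial_mxN U p q i (A : 'rV[R]_n -> 'M[R]_(p, q)) x :
  smooth_mx U A -> U x ->
  partial_mx i (fun y => - A y) x = - partial_mx i A x.
Proof.
move=> sA Ux; apply/matrixP => j k; rewrite !(partial_mxE, mxE) /partial.
under eq_fun do rewrite mxE.
by rewrite [LHS]deriveN //; apply/diff_derivable/(smooth_mx_diff _ _ sA Ux).
Qed.

Lemma partial_mxT p q i (A : 'rV[R]_n -> 'M[R]_(p, q)) x :
  partial_mx i (fun y => (A y)^T) x = (partial_mx i A x)^T.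
Proof.
by apply/matrixP => j k; rewrite !(partial_mxE, mxE) /partial; under eq_fun do rewrite mxE.
Qed.

Lemma partial_mx_row p q i j (A : 'rV[R]_n -> 'M[R]_(p, q)) x :
  partial_mx i (fun y => row j (A y)) x = row j (partial_mx i A x).
Proof.
by apply/matrixP => l k; rewrite !(partial_mxE, mxE) /partial; under eq_fun do rewrite mxE.
Qed.

Lemma partial_mxM U p q r i (A : 'rV[R]_n -> 'M[R]_(p, q))
    (B : 'rV[R]_n -> 'M[R]_(q, r)) x :
  smooth_mx U A -> smooth_mx U B -> U x ->
  partial_mx i (fun y => A y *m B y) x =
    partial_mx i A x *m B x + A x *m partial_mx i B x.
Proof.
move=> sA sB Ux; apply/matrixP => j k; rewrite !(partial_mxE, mxE) /partial.
under eq_fun do rewrite mxE.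
have dA l : differentiable (fun y => A y j l) x by exact: smooth_mx_diff sA Ux.
have dB l : differentiable (fun y => B y l k) x by exact: smooth_mx_diff sB Ux.
have [_ ->] := @derive_bigsum _ _ _ (index_enum 'I_q)
  (fun l y => A y j l * B y l k) x (delta_mx 0 i)
  (fun l => differentiableM (dA l) (dB l)).
rewrite -big_split /=; apply: eq_bigr => l _.
by rewrite derive_mul // !partial_mxE.
Qed.

Lemma partial_mx_sum U p q i (J : finType) (A : J -> 'rV[R]_n -> 'M[R]_(p, q)) x :
  (forall j, smooth_mx U (A j)) -> U x ->
  partial_mx i (fun y => \sum_j A j y) x = \sum_j partial_mx i (A j) x.
Proof.
move=> sA Ux; apply/matrixP => l k; rewrite summxE partial_mxE /partial.
under eq_fun do rewrite summxE.
have dA j : differentiable (fun y => A j y l k) x by exact: smooth_mx_diff (sA j) Ux.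
have [_ ->] := @derive_bigsum _ _ _ (index_enum J)
  (fun j y => A j y l k) x (delta_mx 0 i) dA.
by apply: eq_bigr => j _; rewrite partial_mxE.
Qed.

Lemma partial_comm U i j f x : open U -> smooth_on U f -> U x ->
  partial i (partial j f) x = partial j (partial i f) x.
Proof. by move=> oU sf Ux; exact: derive_comm (sf 2%N) Ux. Qed.

Lemma partial_mx_comm U p q i j (A : 'rV[R]_n -> 'M[R]_(p, q)) x : open U ->
  smooth_mx U A -> U x ->
  partial_mx i (partial_mx j A) x = partial_mx j (partial_mx i A) x.
Proof.
move=> oU sA Ux; apply/matrixP => l k.
have E h : (fun y => partial_mx h A y l k) = partial h (fun y => A y l k).
  by apply/funext => y; exact: partial_mxE.
have E2 h h' : partial_mx h (partial_mx h' A) x l k =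
    partial h (partial h' (fun y => A y l k)) x.
  by rewrite partial_mxE; congr (partial h _ x); exact: E.
apply: etrans (E2 i j) _; apply: etrans _ (esym (E2 j i)).
exact: (partial_comm i j oU (sA l k)).
Qed.

End smooth_matrix.

Lemma smooth_mx_comp (R : realType) n m p q (U : set 'rV[R]_n)
    (Om : set 'rV[R]_m) (F : 'rV[R]_n -> 'rV[R]_m)
    (A : 'rV[R]_m -> 'M[R]_(p, q)) : open U -> (forall x, U x -> Om (F x)) ->
  smooth_on U F -> smooth_mx Om A -> smooth_mx U (fun x => A (F x)).
Proof.
by move=> oU UOm sF sA j k l; apply: (Ck_on_comp_rV oU UOm (sF l) (sA j k l)).
Qed.

Lemma partial_mx_comp (R : realType) n m p q (U : set 'rV[R]_n)
    (Om : set 'rV[R]_m) (i : 'I_n) (F : 'rV[R]_n -> 'rV[R]_m)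
    (A : 'rV[R]_m -> 'M[R]_(p, q)) x : (forall x, U x -> Om (F x)) ->
  smooth_on U F -> smooth_mx Om A -> U x ->
  partial_mx i (fun x => A (F x)) x =
    \sum_a jacobian F x i a *: partial_mx a A (F x).
Proof.
move=> UOm sF sA Ux; apply/matrixP => j k; rewrite summxE partial_mxE.
have dF : differentiable F x by have [d _] := sF 1%N; exact: d.
have dA : differentiable (fun y => A y j k) (F x).
  exact: smooth_on_diff (sA j k) (UOm x Ux).
rewrite [LHS](derive_comp_rV (delta_mx 0 i) dF dA).
by apply: eq_bigr => a _; rewrite deriveEjacobian // -rowE !mxE partial_mxE.
Qed.

(** * Levi-Civita connection and curvature *)

Section matrix_entries.
Context {R : pzRingType} {m n : nat}.
Implicit Types A B : 'M[R]_(m, n).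

Lemma addmxE A B i j : (A + B) i j = A i j + B i j. Proof. by rewrite mxE. Qed.
Lemma oppmxE A i j : (- A) i j = - A i j. Proof. by rewrite mxE. Qed.
Lemma scalemxE a A i j : (a *: A) i j = a * A i j. Proof. by rewrite mxE. Qed.
Lemma zeromxE i j : (0 : 'M[R]_(m, n)) i j = 0. Proof. by rewrite mxE. Qed.
End matrix_entries.

Definition mx_linE := (@addmxE, @oppmxE, @scalemxE, @zeromxE).

Ltac mx_ring := apply/matrixP => ? ?; rewrite !mx_linE; ring.

(** Row [j] holds the components of the derivative of d_j in the direction d_i, so the connection
    acts on row vectors by right multiplication. *)
HB.lock Definition christoffel_mx (R : realType) (n : nat)
    (G : 'rV[R]_n -> 'M[R]_n) (i : 'I_n) (x : 'rV[R]_n) : 'M[R]_n :=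
  \matrix_(j, k) christoffel G k i j x.

Lemma christoffel_entry (R : realType) (n : nat) (G : 'rV[R]_n -> 'M[R]_n) i x j k :
  christoffel_mx G i x j k = christoffel G k i j x.
Proof. by rewrite unlock mxE. Qed.

Section levi_civita.
Context {R : realType} {n : nat}.
Variables (G : 'rV[R]_n -> 'M[R]_n) (Om : set 'rV[R]_n).
Hypotheses (oOm : open Om) (sG : smooth_mx Om G).
Hypotheses (symG : forall x, Om x -> (G x)^T = G x).
Hypotheses (uG : forall x, Om x -> G x \in unitmx).

Local Notation christoffel_mx := (christoffel_mx G).

(** The Christoffel symbols with lowered index, that is <nabla_i d_j, d_l>, as given by the Koszul
    formula for commuting fields. *)
Definition koszul_mx (i : 'I_n) x : 'M[R]_n :=
  \matrix_(j, l) (2^-1 * (partial_mx i G x j l + partial_mx j G x i l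
                          - partial_mx l G x i j)).

Lemma partial_metric_sym l x : Om x -> (partial_mx l G x)^T = partial_mx l G x.
Proof. by move=> Ox; rewrite -partial_mxT; exact: partial_mx_eq Ox. Qed.

Lemma partial_metric_symE l j k x : Om x ->
  partial_mx l G x j k = partial_mx l G x k j.
Proof. by move=> Ox; rewrite -{1}(partial_metric_sym l Ox) mxE. Qed.

Lemma christoffel_mxE i x : christoffel_mx i x = koszul_mx i x *m (invmx (G x))^T.
Proof.
apply/matrixP => j k; rewrite unlock !mxE /christoffel mulr_sumr.
by apply: eq_bigr => l _; rewrite !mxE !partial_mxE mulrCA mulrC.
Qed.

Lemma invmx_sym x : Om x -> (invmx (G x))^T = invmx (G x).
Proof. by move=> Ox; rewrite trmx_inv symG. Qed.

Lemma christoffel_lower i x : Om x -> christoffel_mx i x *m G x = koszul_mx i x.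
Proof. by move=> Ox; rewrite christoffel_mxE invmx_sym // mulmxKV // uG. Qed.

Lemma christoffel_torsion i j x : Om x ->
  row j (christoffel_mx i x) = row i (christoffel_mx j x).
Proof.
move=> Ox; rewrite !christoffel_mxE !row_mul; congr (_ *m _).
apply/rowP => l; rewrite !mxE; congr (_ * (_ - _)); first by rewrite addrC.
by rewrite -[in LHS]partial_metric_sym // mxE.
Qed.

(** The sum symmetrizes the Koszul expression in its last two indices; the derivatives of [G] in the
    directions [j] and [l] then cancel. *)
Lemma metric_compat i x : Om x ->
  partial_mx i G x = christoffel_mx i x *m G x + G x *m (christoffel_mx i x)^T.
Proof.
move=> Ox; rewrite -[X in _ = _ + X *m _]symG // -trmx_mul christoffel_lower //.
apply/matrixP => j l; rewrite !mxE (partial_metric_symE i l j Ox).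
by field.
Qed.

Lemma smooth_mx_christoffel i : smooth_mx Om (christoffel_mx i).
Proof.
have sI : smooth_mx Om (fun x => (invmx (G x))^T).
  exact/smooth_mxT/smooth_mx_invmx.
have sK : smooth_mx Om (koszul_mx i).
  have sP j : smooth_mx Om (partial_mx j G) by exact: smooth_mx_partial.
  move=> j l; apply: (@smooth_on_eq _ _ Om (fun x => 2^-1 *
    (partial_mx i G x j l + partial_mx j G x i l + - 1 * partial_mx l G x i j))) => //.
    by move=> x _; rewrite !mxE mulN1r.
  have c (a : R) := @smooth_on_cst _ _ Om a.
  apply: smooth_onM => //.
  have sPN := smooth_onM oOm (c (-1)) (sP l i j).
  exact: (smooth_onD oOm (smooth_onD oOm (sP i j l) (sP j i l)) sPN).
apply: smooth_mx_eq (smooth_mxM oOm sK sI) => // x _.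
by rewrite christoffel_mxE.
Qed.
End levi_civita.

(* The connection matrices [w i] act on row vectors from the right. *)
HB.lock Definition cov (R : realType) (n m : nat) (w : 'I_n -> 'rV[R]_n -> 'M[R]_m)
    (p : nat) (i : 'I_n) (V : 'rV[R]_n -> 'M[R]_(p, m)) (x : 'rV[R]_n) :
    'M[R]_(p, m) :=
  partial_mx i V x + V x *m w i x.

(** The two products stand in the order opposite to the usual one because the matrices act from the
    right. For the Levi-Civita connection, row [k] is R(d_i, d_j) d_k. *)
HB.lock Definition curvature_mx (R : realType) (n m : nat)
    (w : 'I_n -> 'rV[R]_n -> 'M[R]_m) (i j : 'I_n) (x : 'rV[R]_n) : 'M[R]_m :=
  partial_mx i (w j) x - partial_mx j (w i) x + w j x *m w i x - w i x *m w j x.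

Section curvature.
Context {R : realType} {n m : nat}.
Variables (U : set 'rV[R]_n) (w : 'I_n -> 'rV[R]_n -> 'M[R]_m).
Hypotheses (oU : open U) (sw : forall i, smooth_mx U (w i)).

Local Notation cov := (cov w).
Local Notation curvature_mx := (curvature_mx w).

Lemma covE p i (V : 'rV[R]_n -> 'M[R]_(p, m)) x :
  cov i V x = partial_mx i V x + V x *m w i x.
Proof. by rewrite unlock. Qed.

Lemma curvature_mxE i j x : curvature_mx i j x =
  partial_mx i (w j) x - partial_mx j (w i) x + w j x *m w i x - w i x *m w j x.
Proof. by rewrite unlock. Qed.

Lemma smooth_mx_cov p i (V : 'rV[R]_n -> 'M[R]_(p, m)) :
  smooth_mx U V -> smooth_mx U (cov i V).
Proof.
move=> sV; rewrite unlock; apply: smooth_mxD => //; first exact: smooth_mx_partial.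
exact: smooth_mxM.
Qed.

(** Second derivatives of [V] commute and first ones enter symmetrically in [i] and [j], so only a
    matrix acting on [V] survives. *)
Lemma cov_comm p i j (V : 'rV[R]_n -> 'M[R]_(p, m)) x : smooth_mx U V -> U x ->
  cov i (cov j V) x - cov j (cov i V) x = V x *m curvature_mx i j x.
Proof.
move=> sV Ux.
have E k l : cov k (cov l V) x = partial_mx k (partial_mx l V) x +
    partial_mx k V x *m w l x + V x *m partial_mx k (w l) x +
    partial_mx l V x *m w k x + V x *m w l x *m w k x.
  rewrite covE (partial_mx_eq k oU (fun y _ => covE l V y) Ux) covE.
  rewrite (partial_mxD (U := U)) ?(partial_mxM (U := U)) //.
  - by rewrite mulmxDl !addrA.
  - exact: smooth_mx_partial.
  - exact: smooth_mxM.
rewrite (E i j) (E j i) (partial_mx_comm j i oU sV Ux) curvature_mxE.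
rewrite !(mulmxBr, mulmxDr) !mulmxA; mx_ring.
Qed.
End curvature.

(** [C + C^T] occurs on both sides and cancels. In the application to second derivatives of the
    metric, [C] has one connection matrix on each side of [G], and exchanging the derivatives
    transposes it. *)
Lemma skew_of_symmetrized (R : numDomainType) n (A B C : 'M[R]_n) :
  A + C + (A + C)^T = B + C^T + (B + C^T)^T -> (A - B)^T = - (A - B).
Proof.
move=> H; apply/matrixP => i j; move/matrixP/(_ i j): H; rewrite !mxE => H.
apply/eqP; rewrite -subr_eq0; move/eqP: H; rewrite -subr_eq0 => /eqP <-.
by apply/eqP; ring.
Qed.

Lemma rowD (R : nmodType) m n (A B : 'M[R]_(m, n)) i :
  row i (A + B) = row i A + row i B.
Proof. by apply/rowP => j; rewrite !mxE. Qed.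

Lemma rowN (R : zmodType) m n (A : 'M[R]_(m, n)) i : row i (- A) = - row i A.
Proof. by apply/rowP => j; rewrite !mxE. Qed.

Lemma trmxD (R : nmodType) m n (A B : 'M[R]_(m, n)) : (A + B)^T = A^T + B^T.
Proof. by apply/matrixP => i j; rewrite !mxE. Qed.

Lemma trmxN (R : zmodType) m n (A : 'M[R]_(m, n)) : (- A)^T = - A^T.
Proof. by apply/matrixP => i j; rewrite !mxE. Qed.

Lemma trmxZ (R : pzRingType) m n a (A : 'M[R]_(m, n)) : (a *: A)^T = a *: A^T.
Proof. by apply/matrixP => i j; rewrite !mxE. Qed.

Lemma row_entry (T : Type) m n (A : 'M[T]_(m, n)) i j k : row i A j k = A i k.
Proof. by rewrite mxE. Qed.

(** * Symmetries of the Riemann and Ricci tensors *)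

Section riemann_tensor.
Context {R : realType} {n : nat}.
Variables (G : 'rV[R]_n -> 'M[R]_n) (Om : set 'rV[R]_n).
Hypotheses (oOm : open Om) (sG : smooth_mx Om G).
Hypotheses (symG : forall x, Om x -> (G x)^T = G x).
Hypotheses (uG : forall x, Om x -> G x \in unitmx).

Local Notation Gam := (christoffel_mx G).
Local Notation Riem := (curvature_mx (christoffel_mx G)).

Let sGam i : smooth_mx Om (Gam i).
Proof. exact: smooth_mx_christoffel. Qed.

Lemma riemannE l k i j x : riemann G l k i j x = Riem i j x k l.
Proof.
have E a b : partial_mx a (Gam b) x k l = partial a (christoffel G l b k) x.
  rewrite partial_mxE; congr (partial a _ x).
  by apply/funext => y; rewrite christoffel_entry.
rewrite /riemann curvature_mxE !mx_linE !E -[RHS]addrA; congr (_ + _).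
rewrite [(_ *m _) k l]mxE [(Gam i x *m _) k l]mxE -sumrB; apply: eq_bigr => r _.
by rewrite !christoffel_entry; congr (_ - _); rewrite mulrC.
Qed.

(** Second derivatives of [G] commute; expanded through metric compatibility, their difference is
    the symmetrization of [Riem i j x *m G x], which therefore vanishes. *)
Lemma curvature_skew i j x : Om x ->
  (Riem i j x *m G x)^T = - (Riem i j x *m G x).
Proof.
move=> Ox.
have E a b : partial_mx a (partial_mx b G) x =
    (partial_mx a (Gam b) x *m G x + Gam b x *m Gam a x *m G x
      + Gam b x *m G x *m (Gam a x)^T)
    + (partial_mx a (Gam b) x *m G x + Gam b x *m Gam a x *m G x
      + Gam b x *m G x *m (Gam a x)^T)^T.
  have sC : smooth_mx Om (fun y => Gam b y *m G y) by exact: smooth_mxM.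
  have sCT : smooth_mx Om (fun y => (Gam b y *m G y)^T) by exact: smooth_mxT.
  have -> : partial_mx a (partial_mx b G) x =
      partial_mx a (fun y => Gam b y *m G y + (Gam b y *m G y)^T) x.
    apply: partial_mx_eq Ox => // y Oy; rewrite (metric_compat oOm symG uG b Oy).
    by rewrite trmx_mul symG.
  rewrite (partial_mxD _ sC sCT Ox) partial_mxT (partial_mxM _ (sGam b) sG Ox).
  by rewrite (metric_compat oOm symG uG a Ox) mulmxDr !mulmxA addrA.
have := partial_mx_comm i j oOm sG Ox; rewrite (E i j) (E j i) => H.
have -> : Riem i j x *m G x =
    (partial_mx i (Gam j) x *m G x + Gam j x *m Gam i x *m G x)
    - (partial_mx j (Gam i) x *m G x + Gam i x *m Gam j x *m G x).
  by rewrite curvature_mxE !(mulmxDl, mulNmx); mx_ring.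
apply: skew_of_symmetrized (etrans H _); congr (_ + _ + (_ + _)^T).
  by rewrite !trmx_mul trmxK symG // mulmxA.
by rewrite !trmx_mul trmxK symG // mulmxA.
Qed.

Lemma curvature_anti i j x : Riem j i x = - Riem i j x.
Proof. by rewrite !curvature_mxE; mx_ring. Qed.

(** Absence of torsion allows exchanging a row index with the index of the connection matrix, after
    which the terms cancel in pairs. *)
Lemma bianchi i j k x : Om x ->
  row k (Riem i j x) + row i (Riem j k x) + row j (Riem k i x) = 0.
Proof.
move=> Ox.
have T a b : row a (Gam b x) = row b (Gam a x).
  exact: christoffel_torsion Ox.
have dT a b c : row a (partial_mx c (Gam b) x) = row b (partial_mx c (Gam a) x).
  rewrite -!partial_mx_row; apply: partial_mx_eq Ox => // y Oy.
  exact: christoffel_torsion Oy.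
rewrite !curvature_mxE !(rowD, rowN) !row_mul.
rewrite (dT k j) (dT k i) (dT i j) (T k j) (T k i) (T i j).
mx_ring.
Qed.

Lemma ricciE x j k : ricci G x j k = \sum_i Riem i j x k i.
Proof. by rewrite mxE; apply: eq_bigr => i _; rewrite riemannE. Qed.

(** This is the trace of a skew matrix times the symmetric inverse of [G]. It disposes of the middle
    term when the Bianchi identity is contracted. *)
Lemma curvature_trace0 i j x : Om x -> \tr (Riem i j x) = 0.
Proof.
move=> Ox; set B := Riem i j x.
have /(congr1 (fun A => \tr (A *m invmx (G x)))) := curvature_skew i j Ox.
rewrite mulNmx mulmxK ?uG // linearN /= -/B.
rewrite -mxtrace_tr trmx_mul trmxK (trmx_inv (G x)) symG // mxtrace_mulC.
rewrite mulmxK ?uG // => H; lra.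
Qed.

(** Contracting the Bianchi identity over [i] leaves the difference of two Ricci entries and a
    vanishing trace. *)
Lemma ricci_sym x : Om x -> (ricci G x)^T = ricci G x.
Proof.
move=> Ox; apply/matrixP => k j; rewrite mxE !ricciE.
have : \sum_i (row k (Riem i j x) + row i (Riem j k x) + row j (Riem k i x)) 0 i = 0.
  by rewrite big1 // => i _; rewrite bianchi // mxE.
under eq_bigr do rewrite !mx_linE [row k _ _ _]mxE [row _ (Riem j k x) _ _]mxE
  [row j _ _ _]mxE [Riem k _ _]curvature_anti mx_linE.
rewrite !big_split /= -/(mxtrace _) curvature_trace0 // addr0 sumrN.
by move/eqP; rewrite subr_eq0 => /eqP.
Qed.
End riemann_tensor.

(** * Gauss, Weingarten and Codazzi equations *)

Section pullback_connection.
Context {R : realType} {n m : nat}.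
Variables (G : 'rV[R]_m -> 'M[R]_m) (Om : set 'rV[R]_m).
Hypotheses (oOm : open Om) (sG : smooth_mx Om G).
Hypotheses (symG : forall y, Om y -> (G y)^T = G y).
Hypotheses (uG : forall y, Om y -> G y \in unitmx).
Variables (U : set 'rV[R]_n) (F : 'rV[R]_n -> 'rV[R]_m).
Hypotheses (oU : open U) (sF : smooth_on U F) (UOm : forall x, U x -> Om (F x)).

Local Notation Gam := (christoffel_mx G).
Local Notation Riem := (curvature_mx (christoffel_mx G)).
Local Notation E := (jacobian F).

(** The connection of the pullback by [F] of the ambient tangent bundle: it differentiates ambient
    vectors along the map in the coordinates of its source. *)
Definition pull_conn i x : 'M[R]_m := \sum_a E x i a *: Gam a (F x).

Let sGam a : smooth_mx Om (Gam a).
Proof. exact: smooth_mx_christoffel. Qed.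

Let smF : smooth_mx U F.
Proof. exact: smooth_mx_of. Qed.

Lemma jacobian_row i x : U x -> row i (E x) = partial_mx i F x.
Proof.
move=> Ux; rewrite rowE -deriveEjacobian; last by have [d _] := sF 1%N; exact: d.
rewrite derive_mx; last by apply: diff_derivable; have [d _] := sF 1%N; exact: d.
by apply/matrixP => j k; rewrite partial_mxE mxE.
Qed.

Lemma jacobian_entry i a x : U x -> E x i a = partial_mx i F x 0 a.
Proof. by move=> Ux; rewrite -jacobian_row // row_entry. Qed.

Lemma smooth_mx_jacobian : smooth_mx U E.
Proof.
move=> i a; apply: smooth_on_eq (smooth_mx_partial i oU smF 0 a) => //.
by move=> x Ux; rewrite jacobian_entry.
Qed.

Lemma partial_jacobian_comm i j x : U x ->
  row j (partial_mx i E x) = row i (partial_mx j E x).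
Proof.
move=> Ux; rewrite -!partial_mx_row.
rewrite (partial_mx_eq i oU (fun y => @jacobian_row j y) Ux).
rewrite (partial_mx_eq j oU (fun y => @jacobian_row i y) Ux).
exact: (partial_mx_comm i j oU smF Ux).
Qed.

Lemma smooth_mx_pull p q (A : 'rV[R]_m -> 'M[R]_(p, q)) :
  smooth_mx Om A -> smooth_mx U (fun x => A (F x)).
Proof. exact: smooth_mx_comp. Qed.

Lemma smooth_mx_pull_conn i : smooth_mx U (pull_conn i).
Proof.
apply: smooth_mx_sum => // a; apply: smooth_mxZ => //.
  exact: smooth_mx_jacobian.
exact: smooth_mx_pull.
Qed.

Lemma pull_metric_compat i x : U x ->
  partial_mx i (fun y => G (F y)) x =
    pull_conn i x *m G (F x) + G (F x) *m (pull_conn i x)^T.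
Proof.
move=> Ux; rewrite (partial_mx_comp i UOm sF sG Ux) /pull_conn.
rewrite linear_sum /= mulmx_suml mulmx_sumr -big_split /=.
apply: eq_bigr => a _; rewrite (metric_compat oOm symG uG a (UOm Ux)).
by rewrite linearZ /= -scalemxAl -scalemxAr scalerDr.
Qed.

Lemma cov_inner p q i (V : 'rV[R]_n -> 'M[R]_(p, m)) (W : 'rV[R]_n -> 'M[R]_(q, m)) x :
  smooth_mx U V -> smooth_mx U W -> U x ->
  partial_mx i (fun y => V y *m G (F y) *m (W y)^T) x =
    cov pull_conn i V x *m G (F x) *m (W x)^T
    + V x *m G (F x) *m (cov pull_conn i W x)^T.
Proof.
move=> sV sW Ux; have sGF := smooth_mx_pull sG.
have sVG := smooth_mxM oU sV sGF.
rewrite (partial_mxM _ sVG (smooth_mxT oU sW) Ux) (partial_mxM _ sV sGF Ux).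
rewrite partial_mxT (pull_metric_compat i Ux) !covE trmxD trmx_mul.
rewrite !(mulmxDl, mulmxDr) !mulmxA; mx_ring.
Qed.

(** Combines the symmetry of the second derivatives of [F] with that of the ambient Christoffel
    symbols. *)
Lemma pull_torsion i j x : U x ->
  row j (cov pull_conn i E x) = row i (cov pull_conn j E x).
Proof.
move=> Ux; rewrite !covE !rowD (partial_jacobian_comm i j Ux); congr (_ + _).
rewrite !row_mul /pull_conn !mulmx_sumr.
have X k l : \sum_a row k (E x) *m (E x l a *: Gam a (F x)) =
   \sum_a \sum_b (E x l a * E x k b) *: row b (Gam a (F x)).
  apply: eq_bigr => a _; rewrite -scalemxAr.
  rewrite [row k _ *m _]mulmx_sum_row scaler_sumr; apply: eq_bigr => b _.
  by rewrite row_entry scalerA.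
rewrite !X exchange_big /=; apply: eq_bigr => a _; apply: eq_bigr => b _.
rewrite mulrC; congr (_ *: _).
exact: (christoffel_torsion oOm symG _ _ (UOm Ux)).
Qed.

(** The curvature of a pullback connection is the pullback of the curvature: the second derivatives
    of [F], the only other terms, are symmetric in [i] and [j]. *)
Lemma pull_curvature i j x : U x ->
  curvature_mx pull_conn i j x =
    \sum_a \sum_b (E x i a * E x j b) *: Riem a b (F x).
Proof.
move=> Ux.
have D k l : partial_mx k (pull_conn l) x =
    \sum_b partial_mx k E x l b *: Gam b (F x) +
    \sum_a \sum_b (E x k a * E x l b) *: partial_mx a (Gam b) (F x).
  rewrite /pull_conn (partial_mx_sum _ (U := U)) //; last first.
    move=> b; apply: smooth_mxZ => //; last exact: smooth_mx_pull.
    exact: smooth_mx_jacobian.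
  rewrite exchange_big -big_split /=; apply: eq_bigr => b _.
  rewrite (partial_mxZ _ (smooth_mx_jacobian l b) (smooth_mx_pull (sGam b)) Ux).
  rewrite partial_mxE; congr (_ + _).
  rewrite (partial_mx_comp k UOm sF (sGam b) Ux) scaler_sumr.
  by apply: eq_bigr => a _; rewrite scalerA mulrC.
have M k l : pull_conn k x *m pull_conn l x =
    \sum_b \sum_a (E x l a * E x k b) *: (Gam b (F x) *m Gam a (F x)).
  rewrite /pull_conn mulmx_suml; apply: eq_bigr => b _.
  rewrite mulmx_sumr; apply: eq_bigr => a _.
  by rewrite -scalemxAl -scalemxAr scalerA mulrC.
have C : \sum_b partial_mx i E x j b *: Gam b (F x) =
         \sum_b partial_mx j E x i b *: Gam b (F x).
  apply: eq_bigr => b _; congr (_ *: _).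
  by have /rowP/(_ b) := partial_jacobian_comm i j Ux; rewrite !row_entry.
rewrite curvature_mxE (D i j) (D j i) (M j i) (M i j) C.
rewrite [X in _ + X - _](exchange_big) /=.
rewrite [X in _ + _ - (_ + X) + _ - _](exchange_big) /=.
set c := \sum_b partial_mx j E x i b *: _.
rewrite opprD addrACA subrr add0r -!sumrB -big_split -sumrB /=.
apply: eq_bigr => a _; rewrite -!sumrB -big_split -sumrB /=; apply: eq_bigr => b _.
rewrite curvature_mxE [E x j b * _]mulrC.
mx_ring.
Qed.
End pullback_connection.

HB.lock Definition cov_normal (R : realType) (n m : nat) (G : 'rV[R]_m -> 'M[R]_m)
    (F N : 'rV[R]_n -> 'rV[R]_m) (x : 'rV[R]_n) : 'M[R]_(n, m) :=
  \matrix_(i, k) cov (pull_conn G F) i N x 0 k.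

(** Right multiplication sends an ambient vector to the components of its tangential projection: it
    pairs with the frame, then raises the index by [g]. *)
HB.lock Definition dual_frame (R : realType) (n m : nat) (G : 'rV[R]_m -> 'M[R]_m)
    (F : 'rV[R]_n -> 'rV[R]_m) (g : 'rV[R]_n -> 'M[R]_n) (x : 'rV[R]_n) :
    'M[R]_(m, n) :=
  G (F x) *m (jacobian F x)^T *m invmx (g x).

(* As [dual_frame] inverts [jacobian F] on tangent vectors, this is the matrix [S] with
   [S *m jacobian F = - cov_normal]. *)
HB.lock Definition shape_mx (R : realType) (n m : nat) (G : 'rV[R]_m -> 'M[R]_m)
    (F : 'rV[R]_n -> 'rV[R]_m) (g : 'rV[R]_n -> 'M[R]_n)
    (N : 'rV[R]_n -> 'rV[R]_m) (x : 'rV[R]_n) : 'M[R]_n :=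
  - cov_normal G F N x *m dual_frame G F g x.

Section hypersurface.
Context {R : realType} {n : nat}.
Local Notation m := (1 + n)%N.
Variables (G : 'rV[R]_m -> 'M[R]_m) (Om : set 'rV[R]_m).
Hypotheses (oOm : open Om) (sG : smooth_mx Om G).
Hypotheses (symG : forall y, Om y -> (G y)^T = G y).
Hypotheses (uG : forall y, Om y -> G y \in unitmx).
Variables (U : set 'rV[R]_n) (F : 'rV[R]_n -> 'rV[R]_m).
Hypotheses (oU : open U) (sF : smooth_on U F) (UOm : forall x, U x -> Om (F x)).
Variables (g : 'rV[R]_n -> 'M[R]_n) (N : 'rV[R]_n -> 'rV[R]_m).
Hypotheses (sN : smooth_mx U N).
Hypotheses (gE : forall x, U x ->
  g x = jacobian F x *m G (F x) *m (jacobian F x)^T).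
Hypotheses (ug : forall x, U x -> g x \in unitmx).
Hypotheses (NN : forall x, U x -> N x *m G (F x) *m (N x)^T = (-1)%:M).
Hypotheses (EN : forall x, U x -> jacobian F x *m G (F x) *m (N x)^T = 0).

Local Notation Riem := (curvature_mx (christoffel_mx G)).
Local Notation E := (jacobian F).
Local Notation D := (cov (pull_conn G F)).

Local Notation cov_normal := (cov_normal G F N).
Local Notation dual_frame := (dual_frame G F g).
Local Notation shape_mx := (shape_mx G F g N).

Let dual_frameE x : dual_frame x = G (F x) *m (E x)^T *m invmx (g x).
Proof. by rewrite unlock. Qed.

Let shape_mxE x : shape_mx x = - cov_normal x *m dual_frame x.
Proof. by rewrite unlock. Qed.

Let uGs x : U x -> (G (F x))^T = G (F x).
Proof. by move=> Ux; exact/symG/UOm. Qed.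

Let sE : smooth_mx U E.
Proof. exact: (smooth_mx_jacobian oU sF). Qed.

Let sGF : smooth_mx U (fun x => G (F x)).
Proof. exact: (smooth_mx_pull oU sF UOm sG). Qed.

Let sconn i : smooth_mx U (pull_conn G F i).
Proof. exact: (smooth_mx_pull_conn oOm sG uG oU sF UOm). Qed.

Let sDN i : smooth_mx U (D i N).
Proof. exact: (smooth_mx_cov oU sconn). Qed.

Lemma smooth_mx_induced : smooth_mx U g.
Proof.
apply: (@smooth_mx_eq _ _ U _ _ (fun x => E x *m G (F x) *m (E x)^T)) => //.
  by move=> x Ux; rewrite gE.
apply: smooth_mxM => //; first exact: smooth_mxM.
exact: smooth_mxT.
Qed.

Lemma induced_sym x : U x -> (g x)^T = g x.
Proof. by move=> Ux; rewrite gE // !trmx_mul trmxK symG ?mulmxA //; exact: UOm. Qed.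

Lemma row_cov_normal i x : row i (cov_normal x) = D i N x.
Proof. by apply/rowP => k; rewrite row_entry unlock mxE. Qed.

Lemma smooth_mx_cov_normal : smooth_mx U cov_normal.
Proof.
move=> i k; apply: smooth_on_eq (sDN i 0 k) => // x _.
by rewrite cov_normal.unlock mxE.
Qed.

Lemma smooth_mx_shape : smooth_mx U shape_mx.
Proof.
apply: smooth_mx_eq (fun x _ => esym (shape_mxE x)) _ => //.
apply: smooth_mxM => //; first exact/smooth_mxN/smooth_mx_cov_normal.
apply: smooth_mx_eq (fun x _ => esym (dual_frameE x)) _ => //.
apply: smooth_mxM => //.
  by apply: smooth_mxM => //; exact: smooth_mxT.
by apply: smooth_mx_invmx => //; exact: smooth_mx_induced.
Qed.

Lemma tangent_dual x : U x -> E x *m dual_frame x = 1%:M.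
Proof. by move=> Ux; rewrite dual_frameE !mulmxA -gE // mulmxV // ug. Qed.

Lemma normal_dual x : U x -> N x *m dual_frame x = 0.
Proof.
move=> Ux; rewrite dual_frameE !mulmxA.
have -> : N x *m G (F x) *m (E x)^T = (E x *m G (F x) *m (N x)^T)^T.
  by rewrite !trmx_mul trmxK uGs // mulmxA.
by rewrite EN // trmx0 mul0mx.
Qed.

(* The frame [N, E_1, ..., E_n] has Gram matrix diag(-1, g), hence is a basis. *)
Lemma frame_complete x : U x ->
  dual_frame x *m E x = 1%:M + G (F x) *m (N x)^T *m N x.
Proof.
move=> Ux.
pose Q : 'M[R]_(1 + n) := col_mx (N x) (E x).
pose P : 'M[R]_(1 + n) := row_mx (- (G (F x) *m (N x)^T)) (dual_frame x).
have QP : Q *m P = 1%:M.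
  rewrite /Q /P mul_col_row !mulmxN normal_dual // tangent_dual // !mulmxA NN // EN //.
  by rewrite oppr0 -(raddfN (@scalar_mx R 1)) opprK -scalar_mx_block.
have := mulmx1C QP; rewrite /P /Q mul_row_col mulNmx => <-.
by rewrite addrAC addNr add0r.
Qed.

Lemma cov_normal_normal i x : U x -> D i N x *m G (F x) *m (N x)^T = 0.
Proof.
move=> Ux.
have := cov_inner oOm sG symG uG oU sF UOm i sN sN Ux.
rewrite (partial_mx_eq i oU NN Ux) partial_mx_cst => /matrixP/(_ 0 0).
set A := D i N x *m _ *m _.
have -> : N x *m G (F x) *m (D i N x)^T = A^T.
  by rewrite !trmx_mul trmxK uGs // mulmxA.
rewrite !mx_linE => H.
apply/matrixP => j k; rewrite !ord1 zeromxE.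
move: H; rewrite [A^T 0 0]mxE; lra.
Qed.

(** Differentiating <N, N> = -1 shows that [cov_normal] is tangential, so [frame_complete] rebuilds
    it from its tangential components. *)
Lemma weingarten x : U x -> cov_normal x = - (shape_mx x *m E x).
Proof.
move=> Ux; rewrite shape_mxE -mulmxA frame_complete // mulmxDr mulmx1 !mulNmx.
have -> : cov_normal x *m (G (F x) *m (N x)^T *m N x) = 0.
  apply/row_matrixP => i; rewrite row_mul row_cov_normal !mulmxA.
  by rewrite cov_normal_normal // mul0mx; apply/rowP => k; rewrite row_entry !mxE.
by rewrite oppr0 addr0 opprK.
Qed.

Lemma weingarten_row i x : U x -> D i N x = - (row i (shape_mx x) *m E x).
Proof. by move=> Ux; rewrite -row_cov_normal weingarten // rowN row_mul. Qed.

Lemma second_form i x : U x ->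
  D i E x *m G (F x) *m (N x)^T = (row i (shape_mx x *m g x))^T.
Proof.
move=> Ux.
have := cov_inner oOm sG symG uG oU sF UOm i sE sN Ux.
rewrite (partial_mx_eq i oU EN Ux) partial_mx_cst (weingarten_row i Ux).
rewrite trmxN mulmxN trmx_mul mulmxA -gE // => /eqP.
rewrite eq_sym subr_eq0 => /eqP ->.
by rewrite row_mul trmx_mul induced_sym.
Qed.

(** The entries are <D_i E_k, N>, which [pull_torsion] makes symmetric. *)
Lemma second_form_sym x : U x -> (shape_mx x *m g x)^T = shape_mx x *m g x.
Proof.
move=> Ux; have H i k : (shape_mx x *m g x) i k =
    (row k (D i E x) *m (G (F x) *m (N x)^T)) 0 0.
  rewrite -row_mul mulmxA second_form //.
  by rewrite row_entry [RHS]mxE row_entry.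
apply/matrixP => i k; rewrite [LHS]mxE !H.
by rewrite (pull_torsion oOm symG oU sF UOm k i Ux).
Qed.

(** The products <D_i E_j, E_l> are symmetric in i, j, and symmetrizing them in j, l gives the
    derivatives of [g]; these two properties force the Koszul formula. *)
Lemma gauss_tangent i x : U x ->
  D i E x *m G (F x) *m (E x)^T = christoffel_mx g i x *m g x.
Proof.
move=> Ux; pose X i := D i E x *m G (F x) *m (E x)^T.
have dg k : partial_mx k g x = X k + (X k)^T.
  rewrite (partial_mx_eq k oU gE Ux) (cov_inner oOm sG symG uG oU sF UOm k sE sE Ux).
  by rewrite /X !trmx_mul trmxK uGs // mulmxA.
have Xt a b l : X a b l = X b a l.
  have T c d : X c d l = (row d (D c E x) *m (G (F x) *m (E x)^T)) 0 l.
    by rewrite -row_mul mulmxA row_entry.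
  by rewrite !T (pull_torsion oOm symG oU sF UOm a b Ux).
rewrite (christoffel_lower induced_sym ug) // -/(X i).
apply/matrixP => j l; rewrite [RHS]mxE !dg !addmxE ![(X _)^T _ _]mxE.
rewrite (Xt i l j) (Xt l i j) (Xt j i l) (Xt j l i) (Xt l j i).
by field.
Qed.

(** Decomposition by [frame_complete]; the normal component enters with a minus sign because <N, N>
    = -1. *)
Lemma gauss i x : U x ->
  D i E x = christoffel_mx g i x *m E x - (row i (shape_mx x *m g x))^T *m N x.
Proof.
move=> Ux; have H : D i E x = D i E x *m (dual_frame x *m E x)
    - D i E x *m (G (F x) *m (N x)^T *m N x).
  by rewrite frame_complete // mulmxDr mulmx1 addrK.
rewrite {1}H !mulmxA second_form //; congr (_ *m _ - _).
by rewrite dual_frameE !mulmxA gauss_tangent // mulmxK // ug.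
Qed.

(** Differentiating the Weingarten formula produces [D i E]; the projection kills its normal part,
    and its tangential part supplies the Christoffel term of [g]. *)
Lemma cov_cov_normal i j x : U x ->
  D i (D j N) x *m dual_frame x =
    - row j (cov (christoffel_mx g) i shape_mx x).
Proof.
move=> Ux; have sS := smooth_mx_shape.
have sjS := smooth_mx_row j oU sS.
rewrite [D i _ x]covE (partial_mx_eq i oU (fun y => @weingarten_row j y) Ux).
rewrite (partial_mxN _ (smooth_mxM oU sjS sE) Ux) (partial_mxM _ sjS sE Ux).
rewrite (weingarten_row j Ux) partial_mx_row.
have -> : - (row j (partial_mx i shape_mx x) *m E x
     + row j (shape_mx x) *m partial_mx i E x)
   + - (row j (shape_mx x) *m E x) *m pull_conn G F i x =
   - (row j (partial_mx i shape_mx x) *m E x + row j (shape_mx x) *m D i E x).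
  by rewrite covE mulmxDr !mulNmx !mulmxA; mx_ring.
rewrite gauss //; move: (tangent_dual Ux) (normal_dual Ux).
move: (dual_frame x) => Q EQ NQ.
rewrite covE rowD mulNmx mulmxDl -!mulmxA mulmxBl -!mulmxA EQ NQ.
by rewrite !mulmx0 !mulmx1 subr0 [in RHS]row_mul.
Qed.

(** Two derivatives of [N] are commuted and projected. Row [j] of the derivative of [shape_mx] is
    nabla_i (S d_j), without the correction S (nabla_i d_j); that correction is symmetric in [i] and
    [j] and drops out of the difference. *)
Lemma codazzi i j x : U x ->
  row j (cov (christoffel_mx g) i shape_mx x)
  - row i (cov (christoffel_mx g) j shape_mx x) =
  - (N x *m curvature_mx (pull_conn G F) i j x *m dual_frame x).
Proof.
move=> Ux; rewrite -(cov_comm oU sconn) // mulmxBl !cov_cov_normal //.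
rewrite opprB opprK. by rewrite addrC.
Qed.

(** The contraction runs over tangent directions only, yet yields the full Ricci trace: by
    [frame_complete] the missing normal direction contributes a term <R(., .) N, N>, which is zero
    by skewness. *)
Lemma codazzi_trace j x : U x ->
  \sum_i cov (christoffel_mx g) i shape_mx x j i =
  \sum_i cov (christoffel_mx g) j shape_mx x i i
  - (E x *m ricci G (F x) *m (N x)^T) j 0.
Proof.
move=> Ux.
have -> : (E x *m ricci G (F x) *m (N x)^T) j 0 =
    \sum_i (N x *m curvature_mx (pull_conn G F) i j x *m dual_frame x) 0 i.
  have Q0 a b : N x *m Riem a b (F x) *m (G (F x) *m (N x)^T) = 0.
    pose B := N x *m (Riem a b (F x) *m G (F x)) *m (N x)^T.
    have BT : B^T = - B.
      rewrite /B trmx_mul trmxK trmx_mul (curvature_skew oOm sG symG uG a b (UOm Ux)).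
      by rewrite mulNmx mulmxN mulmxA.
    have HB : N x *m Riem a b (F x) *m (G (F x) *m (N x)^T) = B by rewrite /B !mulmxA.
    apply: (etrans HB); apply/matrixP => k l; rewrite !ord1 zeromxE.
    move/matrixP/(_ 0 0): BT; rewrite [B^T 0 0]mxE oppmxE; lra.
  have H i : (N x *m curvature_mx (pull_conn G F) i j x *m dual_frame x) 0 i =
      \sum_a \sum_b E x j b * ((N x *m Riem a b (F x) *m dual_frame x) 0 i * E x i a).
    rewrite (pull_curvature oOm sG uG oU sF UOm i j Ux) mulmx_sumr mulmx_suml summxE.
    apply: eq_bigr => a _; rewrite mulmx_sumr mulmx_suml summxE.
    apply: eq_bigr => b _; rewrite -scalemxAr -scalemxAl scalemxE; ring.
  rewrite (eq_bigr _ (fun i _ => H i)) exchange_big /=.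
  transitivity (\sum_a \sum_b E x j b * (N x *m Riem a b (F x)) 0 a).
    rewrite exchange_big /= -mulmxA [LHS]mxE; apply: eq_bigr => b _.
    rewrite -mulr_sumr; congr (_ * _).
    under [RHS]eq_bigr do rewrite mxE.
    rewrite exchange_big /= [LHS]mxE; apply: eq_bigr => k _.
    by rewrite ricciE mulr_suml [(N x)^T _ _]mxE; apply: eq_bigr => a _; rewrite mulrC.
  apply: eq_bigr => a _; rewrite exchange_big /=; apply: eq_bigr => b _.
  rewrite -mulr_sumr; congr (_ * _).
  transitivity ((N x *m Riem a b (F x) *m (dual_frame x *m E x)) 0 a).
    by rewrite frame_complete // mulmxDr mulmx1 mulmxA Q0 mul0mx addr0.
  by rewrite mulmxA mxE.
rewrite -sumrN -big_split /=; apply: eq_bigr => i _.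
have /rowP/(_ i) := codazzi i j Ux; rewrite oppmxE => <-.
by rewrite !mx_linE !row_entry addrC subrK.
Qed.
End hypersurface.

(** * Warped products *)

(* With [o] the time coordinate, [warp_row] and [warp_derive] are all that is used
   of the form [- dt^2 + f(t)^2 g_F] of [G]. *)
Section warped_product.
Context {R : realType} {n : nat}.
Local Notation m := (1 + n)%N.
Local Notation o := (lshift n (0 : 'I_1)).
Local Notation e i := (delta_mx (0 : 'I_1) (i : 'I_m) : 'rV[R]_m).
Variables (G : 'rV[R]_m -> 'M[R]_m) (Om : set 'rV[R]_m).
Hypotheses (oOm : open Om) (sG : smooth_mx Om G).
Hypotheses (symG : forall y, Om y -> (G y)^T = G y).
Hypotheses (uG : forall y, Om y -> G y \in unitmx).
Variables f0 f1 f2 : 'rV[R]_m -> R.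
Hypotheses (sf0 : smooth_on Om f0) (sf1 : smooth_on Om f1).
Hypotheses (f0_neq0 : forall y, Om y -> f0 y != 0).
Hypotheses (df0 : forall i y, Om y -> partial i f0 y = (i == o)%:R * f1 y).
Hypotheses (df1 : forall i y, Om y -> partial i f1 y = (i == o)%:R * f2 y).
Hypothesis warp_row : forall y, Om y -> e o *m G y = - e o.
Hypothesis warp_derive : forall y, Om y ->
  partial_mx o G y = (2 * (f1 y / f0 y)) *: (G y + (e o)^T *m e o).

Local Notation Gam := (christoffel_mx G).
Local Notation Riem := (curvature_mx (christoffel_mx G)).

Let sGam i : smooth_mx Om (Gam i).
Proof. exact: smooth_mx_christoffel. Qed.

Lemma warp_row_entry i y : Om y -> G y o i = - e o 0 i.
Proof.
move=> Oy; have /matrixP/(_ 0 i) := warp_row Oy.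
by rewrite -rowE row_entry oppmxE.
Qed.

Lemma warp_partial_row k i y : Om y -> partial_mx k G y o i = 0.
Proof.
move=> Oy; rewrite partial_mxE (partial_eq k oOm (fun y => @warp_row_entry i y) Oy).
exact: derive_cst.
Qed.

(** Row [o] of [G] is constant, so after lowering the index only half the time derivative of [G]
    remains in the Koszul formula. *)
Lemma warp_christoffel_row i y : Om y ->
  e o *m Gam i y = (f1 y / f0 y) *: (e i - (i == o)%:R *: e o).
Proof.
move=> Oy; apply: (can_inj (mulmxK (uG Oy))).
rewrite -scalemxAl mulmxBl -scalemxAl warp_row // -mulmxA.
rewrite (christoffel_lower symG uG) // -!rowE.
apply/rowP => l; rewrite row_entry [LHS]mxE warp_partial_row //.
rewrite (partial_metric_symE oOm symG l i o Oy) warp_partial_row // warp_derive //.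
rewrite !mx_linE row_entry [((e o)^T *m e o) i l]mxE big_ord1 ![(e o)^T _ _]mxE.
rewrite ![e o _ _]mxE eqxx /= (eq_sym i o).
by field; exact: f0_neq0.
Qed.

(** Column [o] holds the time components of the derivatives of all coordinate fields. It follows
    from the row formula by metric compatibility, since [partial_mx i G y] annihilates d/dt. *)
Lemma warp_christoffel_col i y : Om y ->
  Gam i y *m (e o)^T = (f1 y / f0 y) *: (G y *m (e i)^T + (i == o)%:R *: (e o)^T).
Proof.
move=> Oy.
have Ge : G y *m (e o)^T = - (e o)^T by rewrite -[G y]symG // -trmx_mul warp_row // trmxN.
have d0 : partial_mx i G y *m (e o)^T = 0.
  rewrite -(partial_metric_sym oOm symG i Oy) -trmx_mul -rowE.
  by apply/matrixP => k l; rewrite mxE row_entry warp_partial_row // mxE.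
have /(congr1 (fun A => A *m (e o)^T)) := metric_compat oOm symG uG i Oy.
rewrite d0 mulmxDl -!mulmxA Ge mulmxN -trmx_mul warp_christoffel_row //.
move/eqP; rewrite eq_sym addrC subr_eq0 => /eqP <-.
by rewrite trmxZ trmxD trmxN trmxZ -scalemxAr mulmxBr -scalemxAr Ge scalerN opprK.
Qed.

(* [f d/dt] is a closed conformal field. *)
Lemma warp_conformal i y : Om y ->
  cov Gam i (fun y => f0 y *: e o) y = f1 y *: e i.
Proof.
move=> Oy; rewrite covE (partial_mxZ i sf0 (@smooth_mx_cst _ _ Om _ _ (e o)) Oy).
rewrite partial_mx_cst scaler0 addr0 df0 // -scalemxAl warp_christoffel_row //.
apply/matrixP => k l; rewrite !mx_linE; field; exact: f0_neq0.
Qed.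

(** Two covariant derivatives of the conformal field f d/dt are commuted, so the curvature of the
    fibre never enters; the terms in [f1] cancel by absence of torsion. *)
Lemma warp_curvature i j y : Om y ->
  e o *m Riem i j y = (f2 y / f0 y) *: ((i == o)%:R *: e j - (j == o)%:R *: e i).
Proof.
move=> Oy; have se0 : smooth_mx Om (fun y => f0 y *: e o).
  by apply: smooth_mxZ => //; exact: smooth_mx_cst.
have E k l : cov Gam k (cov Gam l (fun y => f0 y *: e o)) y =
    ((k == o)%:R * f2 y) *: e l + f1 y *: (e l *m Gam k y).
  rewrite covE (partial_mx_eq k oOm (fun y => @warp_conformal l y) Oy).
  rewrite (partial_mxZ k sf1 (@smooth_mx_cst _ _ Om _ _ (e l)) Oy).
  by rewrite partial_mx_cst scaler0 addr0 df1 // warp_conformal // -scalemxAl.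
have := cov_comm oOm sGam i j se0 Oy; rewrite !E -(rowE j) -(rowE i).
rewrite (christoffel_torsion oOm symG i j Oy) -scalemxAl.
move/(congr1 (fun A => (f0 y)^-1 *: A)).
rewrite scalerA mulVf ?f0_neq0 // scale1r => <-.
by mx_ring.
Qed.

Lemma warp_ricci y : Om y ->
  ricci G y *m (e o)^T = - (n%:R * (f2 y / f0 y)) *: (e o)^T.
Proof.
move=> Oy; apply/matrixP => j k; rewrite ord1 -[ricci G y]trmxK -trmx_mul -rowE.
rewrite [LHS]mxE row_entry [LHS]mxE ricciE.
have R0 i : Riem i j y o i = (f2 y / f0 y) * ((i == o)%:R * (j == i)%:R - (j == o)%:R).
  have /rowP/(_ i) := warp_curvature i j Oy; rewrite -rowE row_entry => ->.
  by rewrite !mx_linE ![e _ _ _]mxE !eqxx /= (eq_sym i j) mulr1.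
(* For j = o the first sum is 1 and the second 1 + n, whence the factor - n; for other j both
   vanish. *)
rewrite (eq_bigr _ (fun i _ => R0 i)) -mulr_sumr sumrB sumr_const card_ord.
rewrite (bigD1 o) //= big1 ?addr0; last by move=> i /negbTE ->; rewrite mul0r.
rewrite scalemxE [(e o)^T _ _]mxE [e o _ _]mxE. rewrite eqxx /= mul1r -(mulr_natr _ m).
by rewrite natrD; ring.
Qed.
End warped_product.

Lemma partial_comp (R : realType) n m (U : set 'rV[R]_n) (Om : set 'rV[R]_m)
    (f : 'rV[R]_m -> R) (F : 'rV[R]_n -> 'rV[R]_m) i x :
  (forall x, U x -> Om (F x)) -> smooth_on U F -> smooth_on Om f -> U x ->
  partial i (fun x => f (F x)) x = \sum_a jacobian F x i a * partial a f (F x).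
Proof.
move=> UOm sF sf Ux.
have dF : differentiable F x by have [d _] := sF 1%N; exact: d.
have df : differentiable f (F x) by exact: smooth_on_diff sf (UOm x Ux).
rewrite /partial [LHS](derive_comp_rV (delta_mx 0 i) dF df).
by apply: eq_bigr => a _; rewrite deriveEjacobian // -rowE row_entry.
Qed.

Lemma smooth_on_comp_rV (R : realType) n m (U : set 'rV[R]_n) (Om : set 'rV[R]_m)
    (f : 'rV[R]_m -> R) (F : 'rV[R]_n -> 'rV[R]_m) : open U ->
  (forall x, U x -> Om (F x)) -> smooth_on U F -> smooth_on Om f ->
  smooth_on U (fun x => f (F x)).
Proof. by move=> oU UOm sF sf k; exact: Ck_on_comp_rV oU UOm (sF k) (sf k). Qed.

(** * Divergence and Laplacian in coordinates *)

Section divergence.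
Context {R : realType} {n : nat}.
Variables (g : 'rV[R]_n -> 'M[R]_n) (U : set 'rV[R]_n).
Hypotheses (oU : open U) (sg : smooth_mx U g).
Hypotheses (symg : forall x, U x -> (g x)^T = g x).
Hypotheses (ug : forall x, U x -> g x \in unitmx).

Definition divergence (W : 'rV[R]_n -> 'rV[R]_n) x : R :=
  \sum_i cov (christoffel_mx g) i W x 0 i.

Lemma cov_lower i (W : 'rV[R]_n -> 'rV[R]_n) x : smooth_mx U W -> U x ->
  cov (christoffel_mx g) i W x *m g x =
    partial_mx i (fun y => W y *m g y) x - W x *m g x *m (christoffel_mx g i x)^T.
Proof.
move=> sW Ux; rewrite covE (partial_mxM _ sW sg Ux) (metric_compat oU symg ug i Ux).
by rewrite mulmxDl mulmxDr !mulmxA; mx_ring.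
Qed.

(* The vector field with components [W] is the gradient of [u]. *)
Lemma laplacian_div (u : 'rV[R]_n -> R) (W : 'rV[R]_n -> 'rV[R]_n) x :
  smooth_mx U W -> (forall i y, U y -> partial i u y = (W y *m g y) 0 i) -> U x ->
  \tr (invmx (g x) *m hessian g u x) = divergence W x.
Proof.
move=> sW du Ux.
have -> : hessian g u x =
    (\matrix_(i, j) cov (christoffel_mx g) i W x 0 j) *m g x.
  apply/row_matrixP => i; rewrite row_mul.
  have -> : row i (\matrix_(i, j) cov (christoffel_mx g) i W x 0 j) =
      cov (christoffel_mx g) i W x.
    by apply/rowP => j; rewrite row_entry mxE.
  rewrite cov_lower //.
  apply/rowP => j; rewrite row_entry [LHS]mxE !mx_linE; congr (_ - _).
    by rewrite partial_mxE; apply: partial_eq Ux => // y Uy; exact: du.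
  rewrite mxE; apply: eq_bigr => k _.
  by rewrite [(christoffel_mx g i x)^T k j]mxE christoffel_entry du // mulrC.
rewrite mulmxA mxtrace_mulC mulmxA mulmxV ?ug // mul1mx.
by rewrite /mxtrace; apply: eq_bigr => i _; rewrite mxE.
Qed.

Lemma divergenceB (V W : 'rV[R]_n -> 'rV[R]_n) x : smooth_mx U V ->
  smooth_mx U W -> U x ->
  divergence (fun y => V y - W y) x = divergence V x - divergence W x.
Proof.
move=> sV sW Ux; rewrite /divergence -sumrB; apply: eq_bigr => i _.
rewrite !covE (partial_mxD i sV (smooth_mxN oU sW) Ux) (partial_mxN i sW Ux).
by rewrite mulmxBl !mx_linE; ring.
Qed.

Lemma divergenceZ (a : 'rV[R]_n -> R) (W : 'rV[R]_n -> 'rV[R]_n) x : smooth_on U a ->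
  smooth_mx U W -> U x ->
  divergence (fun y => a y *: W y) x =
    \sum_i partial i a x * W x 0 i + a x * divergence W x.
Proof.
move=> sa sW Ux; rewrite /divergence mulr_sumr -big_split; apply: eq_bigr => i _ /=.
by rewrite !covE (partial_mxZ i sa sW Ux) -scalemxAl !mx_linE; ring.
Qed.

(** Since [cov] corrects only the column index of [S], neither of the last two sums is intrinsic. As
    the trace of [S] has zero derivative, the second sum is the trace of
    [christoffel_mx g j x *m S x], exactly the row correction missing from the first. Their
    difference is what [codazzi_trace] evaluates. *)
Lemma divergence_mulmx (W : 'rV[R]_n -> 'rV[R]_n) (S : 'rV[R]_n -> 'M[R]_n) x :
  smooth_mx U W -> smooth_mx U S -> U x ->
  (forall i, \tr (partial_mx i S x) = 0) ->
  divergence (fun y => W y *m S y) x =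
    \sum_i (cov (christoffel_mx g) i W x *m S x) 0 i
    + \sum_j W x 0 j * (\sum_i cov (christoffel_mx g) i S x j i
                        - \sum_i cov (christoffel_mx g) j S x i i).
Proof.
move=> sW sS Ux trS.
have T1 : \sum_i (W x *m cov (christoffel_mx g) i S x) 0 i =
    \sum_j W x 0 j * \sum_i cov (christoffel_mx g) i S x j i.
  under eq_bigr do rewrite mxE.
  by rewrite exchange_big; apply: eq_bigr => j _; rewrite mulr_sumr.
have T2 : \sum_i (W x *m christoffel_mx g i x *m S x) 0 i =
    \sum_j W x 0 j * \sum_i cov (christoffel_mx g) j S x i i.
  have C j : \sum_i cov (christoffel_mx g) j S x i i =
      \sum_i (christoffel_mx g j x *m S x) i i.
    rewrite (eq_bigr (fun i => partial_mx j S x i i + (S x *m christoffel_mx g j x) i i));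
      last by move=> i _; rewrite covE addmxE.
    rewrite big_split /= -/(\tr (partial_mx j S x)) trS add0r.
    exact: mxtrace_mulC.
  under [RHS]eq_bigr do rewrite C mulr_sumr.
  rewrite exchange_big /=; apply: eq_bigr => i _.
  rewrite -mulmxA mxE; apply: eq_bigr => j _; congr (_ * _).
  have : row j (christoffel_mx g i x *m S x) = row i (christoffel_mx g j x *m S x).
    by rewrite !row_mul (christoffel_torsion oU symg i j Ux).
  by move=> /rowP/(_ i); rewrite !row_entry.
under [X in _ = _ + X]eq_bigr do rewrite mulrBr.
rewrite sumrB -T1 -T2 -sumrB -big_split; apply: eq_bigr => i _ /=.
rewrite !covE (partial_mxM i sW sS Ux) mulmxDr mulmxDl !mulmxA !mx_linE; ring.
Qed.
End divergence.

(** * The Laplacian of cosh phi on a hypersurface of a warped product *)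

Section warped_hypersurface.
Context {R : realType} {n : nat}.
Local Notation m := (1 + n)%N.
Local Notation o := (lshift n (0 : 'I_1)).
Local Notation eo := (delta_mx (0 : 'I_1) o : 'rV[R]_m).
Variables (G : 'rV[R]_m -> 'M[R]_m) (Om : set 'rV[R]_m).
Hypotheses (oOm : open Om) (sG : smooth_mx Om G).
Hypotheses (symG : forall y, Om y -> (G y)^T = G y).
Hypotheses (uG : forall y, Om y -> G y \in unitmx).
Variables f0 f1 f2 : 'rV[R]_m -> R.
Hypotheses (sf0 : smooth_on Om f0) (sf1 : smooth_on Om f1).
Hypotheses (f0_neq0 : forall y, Om y -> f0 y != 0).
Hypotheses (df0 : forall i y, Om y -> partial i f0 y = (i == o)%:R * f1 y).
Hypotheses (df1 : forall i y, Om y -> partial i f1 y = (i == o)%:R * f2 y).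
Hypothesis warp_row : forall y, Om y -> eo *m G y = - eo.
Hypothesis warp_derive : forall y, Om y ->
  partial_mx o G y = (2 * (f1 y / f0 y)) *: (G y + eo^T *m eo).
Variables (U : set 'rV[R]_n) (F : 'rV[R]_n -> 'rV[R]_m).
Hypotheses (oU : open U) (sF : smooth_on U F) (UOm : forall x, U x -> Om (F x)).
Variables (g : 'rV[R]_n -> 'M[R]_n) (N : 'rV[R]_n -> 'rV[R]_m).
Hypotheses (sN : smooth_mx U N).
Hypotheses (gE : forall x, U x ->
  g x = jacobian F x *m G (F x) *m (jacobian F x)^T).
Hypotheses (ug : forall x, U x -> g x \in unitmx).
Hypotheses (NN : forall x, U x -> N x *m G (F x) *m (N x)^T = (-1)%:M).
Hypotheses (EN : forall x, U x -> jacobian F x *m G (F x) *m (N x)^T = 0).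
Variable trA : R.
Hypothesis trS : forall x, U x -> \tr (shape_mx G F g N x) = trA.

Local Notation E := (jacobian F).
Local Notation D := (cov (pull_conn G F)).
Local Notation S := (shape_mx G F g N).
Local Notation covg := (cov (christoffel_mx g)).

(* [u] is cosh phi, [t] the differential of the time coordinate, [T] its gradient. *)
Variables (h u : 'rV[R]_n -> R) (t : 'rV[R]_n -> 'cV[R]_n) (T : 'rV[R]_n -> 'rV[R]_n).
Hypotheses (hE : forall x, h x = f1 (F x) / f0 (F x)) (uE : forall x, u x = - N x 0 o).
Hypotheses (tE : forall x, t x = E x *m eo^T).
Hypotheses (TE : forall x, T x = (t x)^T *m invmx (g x)).

Let sE : smooth_mx U E. Proof. exact: (smooth_mx_jacobian oU sF). Qed.
Let sg : smooth_mx U g. Proof. exact: (smooth_mx_induced sG oU sF UOm gE). Qed.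
Let symg x : U x -> (g x)^T = g x. Proof. exact: (induced_sym symG UOm gE). Qed.
Let sS : smooth_mx U S. Proof. exact: (smooth_mx_shape oOm sG uG oU sF UOm sN gE ug). Qed.

Let st : smooth_mx U t.
Proof.
apply: smooth_mx_eq (fun x _ => esym (tE x)) _ => //.
by apply: smooth_mxM => //; exact: smooth_mx_cst.
Qed.

Let sT : smooth_mx U T.
Proof.
apply: smooth_mx_eq (fun x _ => esym (TE x)) _ => //.
by apply: smooth_mxM => //; [exact: smooth_mxT oU st|exact: smooth_mx_invmx].
Qed.

Let su : smooth_on U u.
Proof.
have c := @smooth_on_cst _ _ U (-1).
by apply: smooth_on_eq (smooth_onM oU c (sN 0 o)) => // x _; rewrite uE mulN1r.
Qed.

Let sf0F : smooth_on U (fun x => f0 (F x)).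
Proof. exact: smooth_on_comp_rV oU UOm sF sf0. Qed.

Let sf1F : smooth_on U (fun x => f1 (F x)).
Proof. exact: smooth_on_comp_rV oU UOm sF sf1. Qed.

Let f0F_neq0 x : U x -> f0 (F x) != 0.
Proof. by move=> /UOm; exact: f0_neq0. Qed.

Let sh : smooth_on U h.
Proof.
have sV := smooth_onV oU f0F_neq0 sf0F.
by apply: smooth_on_eq (smooth_onM oU sf1F sV) => // x _; rewrite hE.
Qed.

Let t_entry x i : t x i 0 = E x i o.
Proof.
rewrite tE mxE (bigD1 o) //= big1 => [|a /negbTE ao].
  by rewrite addr0 [eo^T o 0]mxE [eo _ _]mxE !eqxx mulr1.
by rewrite [eo^T a 0]mxE [eo _ _]mxE ao mulr0.
Qed.

Let N_time x : N x *m eo^T = (- u x)%:M.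
Proof.
apply/matrixP => j k; rewrite !ord1 [RHS]mxE eqxx mulr1n uE opprK.
rewrite mxE (bigD1 o) //= big1 => [|a /negbTE ao].
  by rewrite addr0 [eo^T o 0]mxE [eo _ _]mxE !eqxx mulr1.
by rewrite [eo^T a 0]mxE [eo _ _]mxE ao mulr0.
Qed.

Let conn_time i x : U x -> pull_conn G F i x *m eo^T =
  h x *: (G (F x) *m (row i (E x))^T + t x i 0 *: eo^T).
Proof.
move=> Ux; rewrite /pull_conn mulmx_suml.
transitivity (\sum_a h x *: (G (F x) *m (E x i a *: (delta_mx 0 a)^T)
                             + ((a == o)%:R * E x i a) *: eo^T)).
  apply: eq_bigr => a _.
  rewrite -scalemxAl (warp_christoffel_col oOm symG uG f0_neq0 warp_row warp_derive a (UOm Ux)).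
  by rewrite -hE -scalemxAr; mx_ring.
rewrite -scaler_sumr big_split /= -mulmx_sumr -scaler_suml; congr (_ *: (_ *m _ + _ *: _)).
  rewrite [row i (E x)]row_sum_delta linear_sum /=; apply: eq_bigr => a _.
  by rewrite trmxZ row_entry.
rewrite t_entry (bigD1 o) //= big1 ?eqxx ?mul1r ?addr0 // => a /negbTE ->.
by rewrite mul0r.
Qed.

(** Time component of the Gauss formula: [u] comes from the time component - u of [N], and [h] from
    the ambient connection. *)
Let hessian_time i x : U x -> partial_mx i t x =
  christoffel_mx g i x *m t x + u x *: (row i (S x *m g x))^T
  - h x *: (g x *m (delta_mx 0 i)^T + t x i 0 *: t x).
Proof.
move=> Ux.
have -> : partial_mx i t x = partial_mx i E x *m eo^T.
  rewrite (partial_mx_eq i oU (fun y _ => tE y) Ux).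
  rewrite (partial_mxM i sE (@smooth_mx_cst _ _ U _ _ eo^T) Ux) partial_mx_cst.
  by rewrite mulmx0 addr0.
have := gauss oOm sG symG uG oU sF UOm sN gE ug NN EN i Ux.
rewrite covE => /(canRL (addrK _)) ->.
rewrite mulmxBl mulmxBl -!mulmxA -!tE N_time conn_time // -scalemxAr mulmxDr.
rewrite -scalemxAr -(tE x) mulmxA mul_mx_scalar scaleNr opprK; congr (_ - _ *: (_ + _)).
by rewrite gE // rowE trmx_mul !mulmxA.
Qed.

(** Time component of the Weingarten formula; in [conn_time] the part pairing [N] with a tangent
    vector vanishes. *)
Let gradient_u i x : U x ->
  partial i u x = (S x *m t x) i 0 - h x * u x * t x i 0.
Proof.
move=> Ux.
have -> : partial i u x = - (partial_mx i N x *m eo^T) 0 0.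
  rewrite (partial_eq i oU (fun y _ => uE y) Ux) /partial.
  rewrite [LHS]deriveN; last exact/diff_derivable/(smooth_mx_diff _ _ sN Ux).
  congr (- _); rewrite mxE (bigD1 o) //= big1 => [|a /negbTE ao].
    by rewrite addr0 [eo^T o 0]mxE [eo _ _]mxE !eqxx mulr1 partial_mxE.
  by rewrite [eo^T a 0]mxE [eo _ _]mxE ao mulr0.
have := weingarten_row oOm sG symG uG oU sF UOm sN gE ug NN EN i Ux.
rewrite covE => /(canRL (addrK _)) ->.
have NE0 : N x *m (G (F x) *m (row i (E x))^T) = 0.
  rewrite rowE trmx_mul !mulmxA.
  have -> : N x *m G (F x) *m (E x)^T = (E x *m G (F x) *m (N x)^T)^T.
    by rewrite !trmx_mul trmxK symG ?mulmxA //; exact: UOm.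
  by rewrite EN // trmx0 mul0mx.
rewrite mulmxBl mulNmx -!mulmxA -tE conn_time // -scalemxAr mulmxDr NE0 add0r.
rewrite -scalemxAr N_time -row_mul !mx_linE row_entry [(- u x)%:M _ _]mxE eqxx mulr1n.
by ring.
Qed.

Let partial_h i x : U x ->
  partial i h x = (f2 (F x) / f0 (F x) - h x ^+ 2) * t x i 0.
Proof.
move=> Ux.
have comp f f' : smooth_on Om f ->
    (forall i y, Om y -> partial i f y = (i == o)%:R * f' y) ->
    partial i (fun y => f (F y)) x = f' (F x) * t x i 0.
  move=> sf df; rewrite (partial_comp i UOm sF sf Ux) (bigD1 o) //= big1.
    by rewrite addr0 (df o _ (UOm Ux)) eqxx mul1r mulrC t_entry.
  by move=> a /negbTE ao; rewrite (df a _ (UOm Ux)) ao mul0r mulr0.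
rewrite (partial_eq i oU (fun y _ => hE y) Ux) /partial.
have d0 : differentiable (fun y => f0 (F y)) x by exact: smooth_on_diff sf0F Ux.
have d1 : differentiable (fun y => f1 (F y)) x by exact: smooth_on_diff sf1F Ux.
rewrite derive_mul //; last by apply: differentiableV => //; exact: f0F_neq0.
rewrite derive_inv //; last exact: f0F_neq0.
have E0 := comp _ _ sf0 df0; have E1 := comp _ _ sf1 df1.
rewrite /partial in E0 E1; rewrite E0 E1 hE; field; exact: f0F_neq0.
Qed.

Let T_lower x : U x -> T x *m g x = (t x)^T.
Proof. by move=> Ux; rewrite TE mulmxKV // ug. Qed.

Let cov_T i x : U x -> covg i T x =
  u x *: row i (S x) - h x *: (delta_mx 0 i + t x i 0 *: T x).
Proof.
move=> Ux; apply: (can_inj (mulmxK (ug Ux))).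
rewrite (cov_lower oU sg symg ug i sT Ux) T_lower //.
rewrite (partial_mx_eq i oU (fun y => @T_lower y) Ux) partial_mxT hessian_time //.
rewrite mulmxBl -!scalemxAl mulmxDl -scalemxAl T_lower // -row_mul.
rewrite !(trmxD, trmxN, trmxZ) !trmx_mul !trmxK symg //; mx_ring.
Qed.

(** The gradient of the time function is the tangential projection of - d/dt, the sign being that of
    the time block of the metric. *)
Let T_tangent x : U x -> T x *m E x = - eo - u x *: N x.
Proof.
move=> Ux.
have /(congr1 (mulmx eo)) := frame_complete symG UOm gE ug NN EN Ux.
rewrite dual_frame.unlock mulmxDr mulmx1 !mulmxA (warp_row (UOm Ux)) !mulNmx.
have -> : eo *m (E x)^T *m invmx (g x) = T x by rewrite TE tE trmx_mul trmxK.
have -> : eo *m (N x)^T = (- u x)%:M.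
  by rewrite -[LHS]trmxK trmx_mul trmxK N_time tr_scalar_mx.
rewrite mul_scalar_mx => /(congr1 -%R); rewrite opprK => ->.
by rewrite opprB addrC scaleNr.
Qed.

Lemma time_gradient_norm x : U x -> (T x *m t x) 0 0 = u x ^+ 2 - 1.
Proof.
move=> Ux; rewrite tE mulmxA T_tangent // mulmxBl mulNmx -scalemxAl N_time.
rewrite !mx_linE [(- u x)%:M _ _]mxE eqxx mulr1n mxE (bigD1 o) //= big1 => [|a /negbTE ao].
  rewrite addr0 [eo^T o 0]mxE [eo _ _]mxE !eqxx /=; ring.
by rewrite [eo^T a 0]mxE [eo _ _]mxE ao mulr0.
Qed.

Let ricci_T x : U x -> (T x *m (E x *m ricci G (F x) *m (N x)^T)) 0 0 =
  - (n%:R * (f2 (F x) / f0 (F x)) * u x)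
  - u x * (N x *m ricci G (F x) *m (N x)^T) 0 0.
Proof.
move=> Ux; have Ox := UOm Ux.
have eR : eo *m ricci G (F x) = - (n%:R * (f2 (F x) / f0 (F x))) *: eo.
  have := warp_ricci oOm sG symG uG sf0 sf1 f0_neq0 df0 df1 warp_row warp_derive Ox.
  move/(congr1 trmx); rewrite trmx_mul trmxK trmxZ trmxK.
  by rewrite (ricci_sym oOm sG symG uG Ox).
have eN : eo *m (N x)^T = (- u x)%:M.
  by rewrite -[LHS]trmxK trmx_mul trmxK N_time tr_scalar_mx.
rewrite !mulmxA T_tangent // !mulmxBl !mulNmx eR -!scalemxAl eN.
by rewrite !mx_linE [(- u x)%:M _ _]mxE eqxx mulr1n; ring.
Qed.

Lemma laplacian_cosh x : U x ->
  \tr (invmx (g x) *m hessian g u x) =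
    n%:R * (f2 (F x) / f0 (F x)) * u x
    + u x * (N x *m ricci G (F x) *m (N x)^T) 0 0
    - h x * trA - 2 * h x * (T x *m S x *m t x) 0 0 + u x * \tr (S x *m S x)
    + h x ^+ 2 * u x * (n%:R + (u x ^+ 2 - 1)) - h x * u x ^+ 2 * trA
    - (u x ^+ 2 - 1) * (f2 (F x) / f0 (F x) - h x ^+ 2) * u x
    + h x ^+ 2 * u x * (u x ^+ 2 - 1).
Proof.
move=> Ux.
have sTS : smooth_mx U (fun y => T y *m S y) by exact: smooth_mxM.
have shu : smooth_on U (fun y => h y * u y) by exact: smooth_onM.
have shuT : smooth_mx U (fun y => (h y * u y) *: T y) by exact: smooth_mxZ.
have sW : smooth_mx U (fun y => T y *m S y - (h y * u y) *: T y).
  by apply: smooth_mxD => //; exact: smooth_mxN.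
rewrite (laplacian_div oU sg symg ug sW _ Ux); last first.
  move=> i y Uy; rewrite gradient_u // mulmxBl -scalemxAl T_lower //.
  (* Self-adjointness moves [S] across the metric: T S g = T g S^T = (S t)^T. *)
  have -> : T y *m S y *m g y = (S y *m t y)^T.
    rewrite -mulmxA -(second_form_sym oOm sG symG uG oU sF UOm sN gE ug NN EN Uy).
    by rewrite trmx_mul mulmxA symg // T_lower // -trmx_mul.
  by rewrite !mx_linE [(S y *m t y)^T _ _]mxE [(t y)^T _ _]mxE.
rewrite (divergenceB g oU sTS shuT Ux) (divergenceZ g shu sT Ux).
have dS i : \tr (partial_mx i S x) = 0.
  rewrite /mxtrace (eq_bigr (fun j => partial i (fun y => S y j j) x)); last first.
    by move=> j _; rewrite partial_mxE.
  have dSj j : differentiable (fun y => S y j j) x by exact: smooth_mx_diff sS Ux.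
  have [_ <-] := @derive_bigsum _ _ _ (index_enum 'I_n) (fun j y => S y j j) x
    (delta_mx 0 i) dSj.
  by rewrite -/(partial i _ x) (partial_eq i oU trS Ux) /partial derive_cst.
rewrite (divergence_mulmx oU symg sT sS Ux dS).
(* The bracket left by [divergence_mulmx] is replaced by the Ricci term of the traced Codazzi
   equation. *)
have -> : \sum_j T x 0 j * (\sum_i covg i S x j i - \sum_i covg j S x i i) =
   - (T x *m (E x *m ricci G (F x) *m (N x)^T)) 0 0.
  rewrite [in RHS]mxE -sumrN; apply: eq_bigr => j _.
  rewrite (codazzi_trace oOm sG symG uG oU sF UOm sN gE ug NN EN j Ux).
  by rewrite addrAC subrr add0r mulrN.
rewrite ricci_T //.
have sum_t : \sum_i t x i 0 * T x 0 i = u x ^+ 2 - 1.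
  by rewrite -time_gradient_norm // mxE; apply: eq_bigr => i _; rewrite mulrC.
have -> : \sum_i (covg i T x *m S x) 0 i =
    u x * \tr (S x *m S x) - h x * trA - h x * (T x *m S x *m t x) 0 0.
  rewrite -(trS Ux) /mxtrace [(T x *m S x *m t x) 0 0]mxE !mulr_sumr -!sumrB.
  apply: eq_bigr => i _; rewrite cov_T // mulmxBl -!scalemxAl mulmxDl -scalemxAl.
  by rewrite -row_mul -rowE !mx_linE !row_entry; ring.
have -> : divergence g T x =
    u x * trA - h x * (n%:R + (u x ^+ 2 - 1)).
  rewrite -(trS Ux) /mxtrace -sum_t mulrDr opprD addrA [n%:R](_ : _ = \sum_(i < n) 1).
    rewrite !mulr_sumr -!sumrB /divergence; apply: eq_bigr => i _.
    by rewrite cov_T // !mx_linE row_entry [delta_mx _ _ _ _]mxE !eqxx /=; ring.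
  by rewrite sumr_const card_ord.
have -> : \sum_i partial i (fun y => h y * u y) x * T x 0 i =
    (u x ^+ 2 - 1) * (f2 (F x) / f0 (F x) - h x ^+ 2) * u x
    + h x * ((T x *m S x *m t x) 0 0 - h x * u x * (u x ^+ 2 - 1)).
  rewrite -mulmxA [(T x *m _) 0 0]mxE -sum_t [h x * u x * _]mulr_sumr -sumrB !mulr_suml.
  rewrite mulr_sumr -big_split; apply: eq_bigr => i _ /=.
  rewrite /partial derive_mul; [|exact: smooth_on_diff sh Ux|exact: smooth_on_diff su Ux].
  have := gradient_u i Ux; have := partial_h i Ux; rewrite /partial => -> ->.
  ring.
ring.
Qed.
End warped_hypersurface.

(** * The inequality at a point *)

(** Elimination on the first row and column: [L] splits off the positive pivot [a] and leaves the
    Schur complement [D'], again positive definite. The rows of [Q] form an orthonormal basis for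
    [g]. *)
Lemma posdef_congr (R : rcfType) n (g : 'M[R]_n) : g^T = g ->
  (forall v : 'rV[R]_n, v != 0 -> 0 < (v *m g *m v^T) 0 0) ->
  exists Q : 'M[R]_n, Q *m g *m Q^T = 1%:M.
Proof.
elim: n g => [|n IH] g symg posg; first by exists 1%:M; rewrite [LHS]flatmx0 [RHS]flatmx0.
pose g' : 'M[R]_(1 + n) := g.
have symg' : g'^T = g' by [].
have posg' (v : 'rV[R]_(1 + n)) : v != 0 -> 0 < (v *m g' *m v^T) 0 0 by exact: posg.
suff [Q HQ] : exists Q : 'M[R]_(1 + n), Q *m g' *m Q^T = 1%:M by exists Q.
clearbody g'; clear g symg posg.
pose a := g' 0 0; pose b : 'rV[R]_n := ursubmx g'; pose D : 'M[R]_n := drsubmx g'.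
have gE : g' = block_mx a%:M b b^T D.
  rewrite -[LHS]submxK /b trmx_ursub symg'; congr block_mx.
  apply/matrixP => i j; rewrite !ord1 !mxE eqxx mulr1n /a.
  by congr (g' _ _); apply/val_inj.
have a0 : 0 < a.
  have e0 : (delta_mx 0 0 : 'rV[R]_(1 + n)) != 0.
    apply/eqP => /matrixP/(_ 0 0)/eqP; rewrite !mxE !eqxx /= oner_eq0; exact/negP.
  by have := posg' _ e0; rewrite -rowE trmx_delta -colE !mxE.
pose L : 'M[R]_(1 + n) := block_mx 1%:M 0 (- (a^-1 *: b^T)) 1%:M.
pose D' := D - a^-1 *: (b^T *m b).
have LgL : L *m g' *m L^T = block_mx a%:M 0 0 D'.
  rewrite gE /L tr_block_mx !mulmx_block.
  rewrite !(trmx1, trmx0, mul1mx, mul0mx, mulmx1, mulmx0, addr0, add0r).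
  rewrite !trmxN !trmxZ trmxK !mulNmx !mulmxN -!scalemxAl -!scalemxAr.
  rewrite mul_scalar_mx mul_mx_scalar !scalerA mulVf ?gt_eqF // !scale1r !addNr.
  by rewrite mul0mx scaler0 oppr0 add0r addrC.
have symD' : D'^T = D'.
  by rewrite /D' trmxD trmxN trmxZ trmx_mul trmxK /D trmx_drsub symg'.
have posD' (v : 'rV[R]_n) : v != 0 -> 0 < (v *m D' *m v^T) 0 0.
  move=> v0; pose w : 'rV[R]_(1 + n) := row_mx 0 v *m L.
  have w0 : w != 0.
    apply: contraNneq v0 => /(congr1 rsubmx).
    by rewrite /w mul_row_block row_mxKr mul0mx add0r mulmx1 linear0 => ->.
  have := posg' w w0; suff -> : w *m g' *m w^T = v *m D' *m v^T by [].
  rewrite /w trmx_mul !mulmxA -2!(mulmxA (row_mx 0 v)) LgL.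
  rewrite mul_row_block tr_row_mx mul_row_col !(mul0mx, mulmx0, trmx0).
  by rewrite !add0r.
have [Q' HQ'] := IH D' symD' posD'.
exists (block_mx (Num.sqrt a)^-1%:M 0 0 Q' *m L).
rewrite trmx_mul !mulmxA -2!(mulmxA (block_mx _ _ _ _)) LgL tr_block_mx.
rewrite !mulmx_block !(mul0mx, mulmx0, trmx0, addr0, add0r) tr_scalar_mx HQ'.
rewrite -!scalar_mxM [_ * a]mulrC -mulrA -invfM -expr2 sqr_sqrtr ?(ltW a0) //.
by rewrite mulfV ?gt_eqF // -scalar_mx_block.
Qed.

(** [Y] represents the operator in an orthonormal basis, where self-adjointness is symmetry and the
    trace of the square is a sum of squares. *)
Lemma selfadjoint_trace_ge0 (R : rcfType) n (g X : 'M[R]_n) : g^T = g ->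
  (forall v : 'rV[R]_n, v != 0 -> 0 < (v *m g *m v^T) 0 0) ->
  (X *m g)^T = X *m g -> 0 <= \tr (X *m X).
Proof.
move=> symg posg symX; have [Q HQ] := posdef_congr symg posg.
have HQ' : g *m Q^T *m Q = 1%:M by apply: mulmx1C; rewrite mulmxA.
pose Y := Q *m (X *m g) *m Q^T.
have symY : Y^T = Y by rewrite /Y trmx_mul trmxK trmx_mul symX mulmxA.
have -> : \tr (X *m X) = \tr (Y *m Y^T).
  rewrite symY /Y.
  have -> : Q *m (X *m g) *m Q^T *m (Q *m (X *m g) *m Q^T) =
            Q *m X *m (g *m Q^T *m Q) *m X *m (g *m Q^T) by rewrite !mulmxA.
  by rewrite HQ' mulmx1 [RHS]mxtrace_mulC !mulmxA HQ' mul1mx.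
rewrite /mxtrace; apply: sumr_ge0 => i _; rewrite mxE.
by apply: sumr_ge0 => j _; rewrite [Y^T _ _]mxE -expr2 sqr_ge0.
Qed.

Section timelike.
Context {R : rcfType} {n : nat}.
Variables (g ric : 'M[R]_n) (e N : 'rV[R]_n) (u c : R).

(* The limit of the condition at the timelike vectors [N + mu e] as they tend
   to a null vector. *)
Lemma tcc_null : g^T = g -> ric^T = ric -> e *m g = - e -> e *m e^T = 1%:M ->
  N *m g *m N^T = (-1)%:M -> N *m e^T = (- u)%:M -> ric *m e^T = - c *: e^T ->
  (forall z : 'rV[R]_n, (z *m g *m z^T) 0 0 < 0 -> 0 <= (z *m ric *m z^T) 0 0) ->
  1 <= u ^+ 2 -> c <= 0 /\ 0 <= (N *m ric *m N^T) 0 0 + c.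
Proof.
move=> symg symr eg ee NN Ne re tcc u1.
have ge : g *m e^T = - e^T by rewrite -symg -trmx_mul eg trmxN.
have er : e *m ric = - c *: e by rewrite -symr -[e]trmxK -trmx_mul re trmxZ !trmxK.
have eN : e *m N^T = (- u)%:M by rewrite -[LHS]trmxK trmx_mul trmxK Ne tr_scalar_mx.
have s00 a : (a%:M : 'M[R]_1) 0 0 = a by rewrite mxE eqxx mulr1n.
have c0 : c <= 0.
  have := tcc e; rewrite eg mulNmx ee er -scalemxAl ee !mx_linE !s00 mulr1 oppr_ge0.
  by apply; rewrite oppr_lt0.
split=> //.
(* At [N + mu *: e] both forms depend on [mu] only through q = 2 mu u - mu^2: the metric gives q - 1
   and the Ricci form Ric(N, N) + c q. The null limit is q = 1. *)
have key mu : 2 * mu * u - mu ^+ 2 < 1 ->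
    0 <= (N *m ric *m N^T) 0 0 + c * (2 * mu * u - mu ^+ 2).
  have := tcc (N + mu *: e).
  rewrite !trmxD !trmxZ !mulmxDl !mulmxDr -!scalemxAl -!scalemxAr.
  rewrite -![_ *m g *m e^T]mulmxA ge -![_ *m ric *m e^T]mulmxA re eg er.
  rewrite !mulmxN -!scalemxAr -?scalemxAl ?mulNmx NN Ne ee eN !mx_linE !s00 => H1 H2.
  have -> : (N *m ric *m N^T) 0 0 + c * (2 * mu * u - mu ^+ 2) =
      (N *m ric *m N^T) 0 0 + mu * (- c * - u)
      + (mu * (- c * - u) + mu * (mu * (- c * 1))) by ring.
  by apply: H1; nra.
rewrite leNgt; apply/negP => lt0.
pose d := - ((N *m ric *m N^T) 0 0 + c).
(* If the bound failed by [d], this [q] below 1 would still give Ric(N, N) + c q <= - d / 2. It is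
   attained at mu = u + s, where u^2 >= 1 > q makes the root [s] real. *)
pose q := 1 - d / (2 * (1 - c)).
have c1 : 0 < 2 * (1 - c) by lra.
have d0 : 0 < d by rewrite /d; lra.
have dc : 0 < d / (2 * (1 - c)) by rewrite divr_gt0.
pose s := Num.sqrt (u ^+ 2 - q).
have s2 : s ^+ 2 = u ^+ 2 - q by rewrite sqr_sqrtr // /q; lra.
have qE : 2 * (u + s) * u - (u + s) ^+ 2 = q.
  by have -> : 2 * (u + s) * u - (u + s) ^+ 2 = u ^+ 2 - s ^+ 2 by [ring|]; rewrite s2; ring.
have := key (u + s); rewrite qE => /(_ _) H.
have {H} : 0 <= (N *m ric *m N^T) 0 0 + c * q by apply: H; rewrite /q; lra.
have -> : (N *m ric *m N^T) 0 0 + c * q = - d + (- c) * (d / (2 * (1 - c))).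
  by rewrite /q /d; ring.
rewrite leNgt => /negP; apply.
have : (- c) * (d / (2 * (1 - c))) <= d / 2.
  rewrite mulrA ler_pdivrMr // -mulrA mulrCA; nra.
lra.
Qed.
End timelike.

(** Linear algebra at one point: [k] stands for f''/f and [r] for Ric(N, N), and the factor of [u]
    on the right is the value found in [laplacian_cosh] with tr S = - n H. *)
Lemma cosh_laplacian_bound (R : rcfType) n (g S : 'M[R]_n) (t : 'cV[R]_n)
    (T : 'rV[R]_n) (u h k H r : R) : g^T = g ->
  (forall v : 'rV[R]_n, v != 0 -> 0 < (v *m g *m v^T) 0 0) ->
  (S *m g)^T = S *m g -> T *m g = t^T -> (T *m t) 0 0 = u ^+ 2 - 1 ->
  \tr S = - (n%:R * H) -> (0 < n)%N -> n%:R * k <= 0 -> 0 <= r + n%:R * k ->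
  1 <= u ^+ 2 ->
  (u ^+ 2 - 1) * (n%:R / 2 * H + h * u) ^+ 2
    + n%:R * (u ^+ 2 - 1) * (h ^+ 2 - n%:R / 4 * H ^+ 2)
    + h ^+ 2 * (u ^+ 2 - 1) ^+ 2 <=
  u * (n%:R * k * u + u * r - h * - (n%:R * H) - 2 * h * (T *m S *m t) 0 0
       + u * \tr (S *m S) + h ^+ 2 * u * (n%:R + (u ^+ 2 - 1))
       - h * u ^+ 2 * - (n%:R * H)
       - (u ^+ 2 - 1) * (k - h ^+ 2) * u + h ^+ 2 * u * (u ^+ 2 - 1)).
Proof.
move=> symg posg symS Tg Tt trS n0 nk0 rnk u1.
have k0 : k <= 0 by move: nk0; rewrite pmulr_rle0 // ltr0n.
(* [X] is the Hessian of the time function, up to the factor [g]. *)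
pose X := u *: S - h *: (1%:M + t *m T).
have gT : g *m T^T = t by rewrite -[LHS]trmxK trmx_mul trmxK symg Tg trmxK.
have symX : (X *m g)^T = X *m g.
  rewrite /X mulmxBl -!scalemxAl mulmxDl mul1mx -mulmxA Tg.
  by rewrite trmxD trmxN !trmxZ trmxD symS symg trmx_mul trmxK.
have trTt : \tr (t *m T) = u ^+ 2 - 1.
  by rewrite mxtrace_mulC -Tt /mxtrace big_ord1.
have trXX : \tr (X *m X) = u ^+ 2 * \tr (S *m S)
    - 2 * u * h * (\tr S + (T *m S *m t) 0 0)
    + h ^+ 2 * (n%:R + 2 * (u ^+ 2 - 1) + (u ^+ 2 - 1) ^+ 2).
  have trST : \tr (S *m (t *m T)) = (T *m S *m t) 0 0.
    by rewrite mulmxA mxtrace_mulC mulmxA /mxtrace big_ord1.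
  have trtTS : \tr (t *m T *m S) = (T *m S *m t) 0 0 by rewrite mxtrace_mulC trST.
  have trtt : \tr (t *m T *m (t *m T)) = (u ^+ 2 - 1) ^+ 2.
    rewrite mulmxA -(mulmxA t T t) [T *m t]mx11_scalar Tt mul_mx_scalar.
    by rewrite -scalemxAl linearZ /= trTt expr2.
  rewrite /X mulmxBl !mulmxBr -!scalemxAl -!scalemxAr !mulmxDl !mulmxDr.
  have trN (A : 'M[R]_n) : \tr (- A) = - \tr A by exact: raddfN.
  rewrite !mul1mx !mulmx1 !(mxtraceD, trN, mxtraceZ).
  rewrite mxtrace1 trST trtTS trtt trTt; ring.
have X0 := selfadjoint_trace_ge0 symg posg symX; rewrite trXX trS in X0.
have B0 : 0 <= u ^+ 2 * (r + n%:R * k - (u ^+ 2 - 1) * k).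
  rewrite mulr_ge0 ?sqr_ge0 //.
  have : 0 <= (u ^+ 2 - 1) * - k by rewrite mulr_ge0 ?subr_ge0 // oppr_ge0.
  lra.
rewrite -subr_ge0.
(* The two sides of the claim differ exactly by the sum of these two nonnegative terms. *)
have := addr_ge0 X0 B0; set lhs := (X in 0 <= X -> _) => lhs0.
set rhs := (X in 0 <= X); suff -> : rhs = lhs by [].
by rewrite /rhs /lhs; field.
Qed.

Lemma cosh2_sinh2 (R : realType) (x : R) : sinh x ^+ 2 = cosh x ^+ 2 - 1.
Proof.
rewrite /sinh /cosh; have := expRxMexpNx_1 x.
move: (expR x) (expR (- x)) => a b ab.
have -> : ((a + b) / 2) ^+ 2 = ((a - b) / 2) ^+ 2 + a * b by field.
by rewrite ab addrK.
Qed.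

Lemma hessian_entry (R : realType) n (G : 'rV[R]_n -> 'M[R]_n) u x i j :
  hessian G u x i j =
    partial i (partial j u) x - \sum_(k < n) christoffel G k i j x * partial k u x.
Proof. by rewrite mxE. Qed.

Lemma eq_hessian (R : realType) n (G : 'rV[R]_n -> 'M[R]_n) (u v : 'rV[R]_n -> R)
    (U : set 'rV[R]_n) x : open U -> (forall y, U y -> u y = v y) -> U x ->
  hessian G u x = hessian G v x.
Proof.
move=> oU uv Ux; apply/matrixP => i j.
apply: etrans (hessian_entry G u x i j) (etrans _ (esym (hessian_entry G v x i j))).
apply: (congr2 (fun a b : R => a - b)).
  by apply: partial_eq Ux => // y Uy; exact: partial_eq Uy.
apply: eq_bigr => k _; apply: (congr2 (fun a b : R => a * b) erefl).
exact: partial_eq Ux.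
Qed.

Lemma posdef_unitmx (R : rcfType) n (g : 'M[R]_n) : g^T = g ->
  (forall v : 'rV[R]_n, v != 0 -> 0 < (v *m g *m v^T) 0 0) -> g \in unitmx.
Proof.
move=> sg pg; have [Q] := posdef_congr sg pg.
by rewrite -mulmxA => /mulmx1_unit [_]; rewrite unitmx_mul => /andP[].
Qed.

(** * From charts to coordinates *)

Section warped_metric.
Context {R : realType} {n : nat}.
Local Notation m := (1 + n)%N.
Local Notation o := (lshift n (0 : 'I_1)).
Local Notation eo := (delta_mx (0 : 'I_1) o : 'rV[R]_m).
Variables (I : set R) (f : R -> R) (V : set 'rV[R]_n) (k : 'rV[R]_n -> 'M[R]_n).
Hypotheses (oI : open I) (oV : open V) (sf : smooth_on I f).
Hypotheses (f0 : forall s, I s -> 0 < f s).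
Hypotheses (sk : smooth_mx V k) (symk : forall y, V y -> (k y)^T = k y).
Hypotheses (posk : forall y (v : 'rV[R]_n), V y -> v != 0 -> 0 < (v *m k y *m v^T) 0 0).

Definition warped_dom : set 'rV[R]_m := [set y : 'rV[R]_m | I (y 0 o) /\ V (rsubmx y)].

Definition warped_mx (y : 'rV[R]_m) : 'M[R]_m :=
  block_mx (-1)%:M 0 0 (f (lsubmx y 0 0) ^+ 2 *: k (rsubmx y)).

Lemma dt_delta : dt R n = eo.
Proof.
apply/rowP => j; rewrite /dt; case: (split_ordP j) => j' ->.
  by rewrite row_mxEl !ord1 !mxE !eqxx.
by rewrite row_mxEr !mxE eq_rlshift andbF.
Qed.

Lemma lsubmx00 (y : 'rV[R]_m) : lsubmx y 0 0 = y 0 o.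
Proof. by rewrite mxE. Qed.

Lemma open_warped_dom : open warped_dom.
Proof.
apply: openI; apply: open_comp => // y _.
  exact: coord_continuous.
exact: continuous_rsubmx.
Qed.

Let time_is_linear : linear (fun y : 'rV[R]_m => y 0 o : R^o).
Proof. by move=> a y z; rewrite !mxE. Qed.

(** [f] lives on the line, whereas [Ck_on_comp_rV] concerns functions of row vectors; as a bundled
    linear map, the time coordinate falls under [Ck_on_comp_linear] and [derive_comp_linear]. *)
Lemma time_linear : exists2 L : {linear 'rV[R]_m -> R^o},
  continuous L & forall y, L y = y 0 o.
Proof.
pose LM := GRing.isLinear.Build _ _ _ _ _ time_is_linear.
pose L : {linear _ -> _} := HB.pack (fun y : 'rV[R]_m => y 0 o : R^o) LM.
by exists L => //; exact: coord_continuous.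
Qed.

Lemma smooth_time (phi : R -> R) : smooth_on I phi ->
  smooth_on warped_dom (fun y => phi (y 0 o)).
Proof.
move=> sphi j; have [L cL LE] := time_linear.
have -> : (fun y : 'rV[R]_m => phi (y 0 o)) = phi \o L.
  by apply/funext => y /=; rewrite LE.
by apply: (Ck_on_comp_linear cL _ (sphi j)) => y [Iy _]; rewrite LE.
Qed.

Lemma partial_time (phi : R -> R) i y :
  partial i (fun y => phi (y 0 o)) y = (i == o)%:R * derive1 phi (y 0 o).
Proof.
have [L cL LE] := time_linear.
have -> : (fun y : 'rV[R]_m => phi (y 0 o)) = phi \o L.
  by apply/funext => z /=; rewrite LE.
rewrite /partial derive_comp_linear !LE mxE eqxx /= (eq_sym o i).
by case: eqP => _; rewrite ?mul1r ?derive1E // derive0 mul0r.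
Qed.

Lemma smooth_fiber i j : smooth_on warped_dom (fun y => k (rsubmx y) i j).
Proof.
move=> l.
apply: (@Ck_on_comp_linear _ _ _ _ l (rsubmx : {linear 'rV[R]_m -> 'rV[R]_n}) V _
  (fun y => k y i j)); first exact: continuous_rsubmx.
  by move=> y [].
exact: sk.
Qed.

Lemma partial_fiber i j y : partial o (fun y => k (rsubmx y) i j) y = 0.
Proof.
rewrite /partial.
rewrite [LHS](@derive_comp_linear _ _ _ _ (rsubmx : {linear 'rV[R]_m -> 'rV[R]_n})
  (fun y => k y i j)).
suff -> : (rsubmx : {linear 'rV[R]_m -> 'rV[R]_n}) eo = 0 by exact: derive0.
by apply/rowP => l; rewrite !mxE eq_rlshift andbF.
Qed.

Lemma warped_mx_ul i j y : warped_mx y (lshift n i) (lshift n j) = -1.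
Proof. by rewrite block_mxEul !ord1 mxE eqxx mulr1n. Qed.

Lemma warped_mx_ur i j y : warped_mx y (lshift n i) (rshift 1 j) = 0.
Proof. by rewrite block_mxEur mxE. Qed.

Lemma warped_mx_dl i j y : warped_mx y (rshift 1 i) (lshift n j) = 0.
Proof. by rewrite block_mxEdl mxE. Qed.

Lemma warped_mx_dr i j y : warped_mx y (rshift 1 i) (rshift 1 j) =
  f (y 0 o) * f (y 0 o) * k (rsubmx y) i j.
Proof. by rewrite block_mxEdr mxE lsubmx00 expr2. Qed.

Definition warped_mxE := (warped_mx_ul, warped_mx_ur, warped_mx_dl, warped_mx_dr).

Lemma smooth_warped_mx : smooth_mx warped_dom warped_mx.
Proof.
have oD := open_warped_dom; have sft := smooth_time sf.
have c a : smooth_on warped_dom (fun _ : 'rV[R]_m => a : R) by exact: smooth_on_cst.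
move=> i j; case: (split_ordP i) => i' ->; case: (split_ordP j) => j' ->.
- by apply: smooth_on_eq (c (-1)) => // y _; rewrite warped_mxE.
- by apply: smooth_on_eq (c 0) => // y _; rewrite warped_mxE.
- by apply: smooth_on_eq (c 0) => // y _; rewrite warped_mxE.
apply: smooth_on_eq (smooth_onM oD (smooth_onM oD sft sft) (smooth_fiber i' j')) => //.
by move=> y _; rewrite warped_mxE.
Qed.

Lemma warped_mx_sym y : warped_dom y -> (warped_mx y)^T = warped_mx y.
Proof.
by move=> [_ Vy]; rewrite tr_block_mx !trmx0 tr_scalar_mx trmxZ symk.
Qed.

Lemma warped_mx_unit y : warped_dom y -> warped_mx y \in unitmx.
Proof.
move=> [Iy Vy]; rewrite unitmxE /warped_mx det_ublock unitrM -!unitmxE.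
rewrite lsubmx00 unitmxZ ?unitfE ?expf_neq0 ?gt_eqF ?f0 //.
rewrite (posdef_unitmx (symk Vy)) ?andbT; last by move=> v; exact: posk.
by rewrite unitmxE det_scalar expr1 unitrN unitr1.
Qed.

Lemma warped_mx_row y : eo *m warped_mx y = - eo.
Proof.
rewrite -rowE; apply/rowP => j; rewrite row_entry oppmxE.
case: (split_ordP j) => j' ->; rewrite warped_mxE.
  by rewrite !ord1 mxE !eqxx.
by rewrite mxE eq_rlshift andbF oppr0.
Qed.

(** Adding [eo^T *m eo] cancels the time block -1 and leaves f^2 g_F, whose logarithmic time
    derivative is 2 f'/f. *)
Lemma warped_mx_derive y : warped_dom y -> partial_mx o warped_mx y =
  (2 * (derive1 f (y 0 o) / f (y 0 o))) *: (warped_mx y + eo^T *m eo).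
Proof.
move=> Dy; have oD := open_warped_dom; have sft := smooth_time sf.
have eoE i j : (eo^T *m eo) i j = eo 0 i * eo 0 j.
  by rewrite mxE big_ord1 mxE.
have cE c i j : (forall y, warped_mx y i j = c) -> partial_mx o warped_mx y i j = 0.
  move=> H; rewrite partial_mxE.
  by rewrite (partial_eq o oD (fun y _ => H y) Dy) /partial derive_cst.
apply/matrixP => i j; rewrite scalemxE addmxE eoE.
case: (split_ordP i) => i' ->; case: (split_ordP j) => j' ->.
- rewrite (cE (-1)); last by move=> z; rewrite warped_mxE.
  by rewrite warped_mxE !ord1 mxE !eqxx /= mulr1 addNr mulr0.
- rewrite (cE 0); last by move=> z; rewrite warped_mxE.
  by rewrite warped_mxE [eo 0 (rshift _ _)]mxE eq_rlshift andbF mulr0 addr0 mulr0.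
- rewrite (cE 0); last by move=> z; rewrite warped_mxE.
  by rewrite warped_mxE [eo 0 (rshift _ _)]mxE eq_rlshift andbF mul0r addr0 mulr0.
rewrite warped_mxE [eo 0 (rshift _ _)]mxE eq_rlshift andbF mul0r addr0 partial_mxE.
rewrite (partial_eq o oD (fun y _ => warped_mx_dr i' j' y) Dy).
have df : differentiable (fun y : 'rV[R]_m => f (y 0 o)) y by exact: smooth_on_diff sft Dy.
have dk := smooth_on_diff (smooth_fiber i' j') Dy.
have Pf := partial_time f o y; have Pk := partial_fiber i' j' y.
rewrite /partial in Pf Pk *; rewrite derive_mul //; last exact: differentiableM.
rewrite derive_mul // Pf Pk eqxx mul1r. field.
by rewrite gt_eqF //; case: Dy => /f0.
Qed.
End warped_metric.

Local Notation coord := Defs.coord.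

(** Within the open image of the chart [a], this is the preimage of [dom b] under [h \o param a],
    continuous there. *)
Lemma open_rep_dom (R : realType) m n (S T : topologicalType) (A : atlas R m S)
    (B : atlas R n T) (h : S -> T) (a : chart A) (b : chart B) :
  is_chart a -> continuous h -> open (dom b) -> open (rep_dom h a b).
Proof.
move=> [oa ocoord paramK _ cparam] ch ob; rewrite openE => x Ux.
have ax : (coord a @` dom a) x by case: Ux => q [aq _] <-; exists q.
have bx : dom b (h (param a x)) by case: Ux => q [aq bq] <-; rewrite paramK.
have ocx : {for x, continuous (h \o param a)}.
  by apply: continuous_comp; [exact: cparam|exact: ch].
have nb : \forall y \near x, dom b (h (param a y)).
  by apply: ocx; exact: open_nbhs_nbhs.
have na : \forall y \near x, (coord a @` dom a) y by exact: open_nbhs_nbhs.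
apply: filterS2 na nb => y [q aq <-] bq; exists q => //; split=> //.
by move: bq; rewrite paramK.
Qed.

Lemma open_setM (S T : topologicalType) (A : set S) (B : set T) :
  open A -> open B -> open (A `*` B).
Proof.
move=> oA oB; have -> : A `*` B = (fst @^-1` A) `&` (snd @^-1` B) by [].
by apply: openI; apply: open_comp => // x _; [exact: cvg_fst|exact: cvg_snd].
Qed.

Lemma warped_coord_image (R : realType) n (F : Type) (I : set R) (A : atlas R n F)
    (c : chart A) :
  coord (c : chart (warped_atlas I A)) @` dom (c : chart (warped_atlas I A)) =
  warped_dom I (coord c @` dom c).
Proof.
apply/seteqP; split=> y.
  move=> [[s q] [/= Is cq] <-]; split; last by rewrite row_mxKr; exists q.
  by rewrite row_mxEl mxE eqxx mulr1n.
move=> [Iy [q cq qy]]; exists (y 0 (lshift n 0), q) => //=.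
rewrite qy -[RHS]hsubmxK; congr row_mx.
by apply/matrixP => i j; rewrite !ord1 !mxE eqxx mulr1n.
Qed.

Theorem lemma2 (R : realType) (n : nat) (hn : (2 <= n)%N)
  (F : topologicalType) (AF : atlas R n F)
  (hF : smooth_manifold AF) (hFconn : connected [set: F])
  (gF : tensor2 AF) (hgF : riemannian_metric gF)
  (I : set R) (hIopen : open I) (hIint : is_interval I)
  (f : R -> R) (hfsmooth : smooth_on I f) (hfpos : forall t, I t -> 0 < f t)
  (hTCC : timelike_convergence (warped_metric I f gF))
  (M : topologicalType) (AM : atlas R n M) (hM : smooth_manifold AM)
  (psi : M -> R * F) (gM : tensor2 AM)
  (hpsi : spacelike_immersion psi gM (warped_metric I f gF))
  (N : chart (warped_atlas I AF) -> M -> 'rV[R]_(1 + n))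
  (hNfield : vector_field_along AM psi N)
  (hNnormal : unit_timelike_normal AM psi (warped_metric I f gF) N)
  (hNorient : forall (c : chart (warped_atlas I AF)) (p : M), dom c (psi p) ->
     0 < inner (warped_metric I f gF) c (psi p) (N c p) (dt R n))
  (H : R)
  (hH : forall (a : chart AM) (c : chart (warped_atlas I AF)) (p : M),
     dom a p -> dom c (psi p) ->
     mean_curvature psi (warped_metric I f gF) N a c p = H)
  (phi : M -> R) (hphi0 : forall p, 0 <= phi p)
  (hphi : forall (c : chart (warped_atlas I AF)) (p : M), dom c (psi p) ->
     cosh (phi p) = inner (warped_metric I f gF) c (psi p) (N c p) (dt R n))
  (a : chart AM) (p : M) (hp : dom a p) :
  let tau := fun q : M => (psi q).1 in
  cosh (phi p) * laplacian gM a (fun q => cosh (phi q)) p >=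
    sinh (phi p) ^+ 2
      * (n%:R / 2 * H + derive1 f (tau p) / f (tau p) * cosh (phi p)) ^+ 2
    + n%:R * sinh (phi p) ^+ 2
      * (derive1 f (tau p) ^+ 2 / f (tau p) ^+ 2 - n%:R / 4 * H ^+ 2)
    + derive1 f (tau p) ^+ 2 / f (tau p) ^+ 2 * sinh (phi p) ^+ 4.
Proof.
cbv zeta.
have [[psic psiB sPsi] rfE pbM [_ sgM symM posM]] := hpsi.
have [c cp] := psiB p.
have [_ _ _ chM _] := hM; have [_ _ _ chF _] := hF.
pose cF : chart AF := c.
have cha := chM a; have chc := chF cF.
have [oa oca paramKa _ _] := cha; have [ocF occF paramKc _ _] := chc.
have [_ sgF symF posF] := hgF.
(* The claim is local, so it suffices to work on the part of the chart [a] that [psi] sends into a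
   single product chart around [psi p]. *)
pose U : set 'rV[R]_n := rep_dom psi a (c : chart (warped_atlas I AF)).
pose Psi := rep psi a (c : chart (warped_atlas I AF)).
pose V : set 'rV[R]_n := coord cF @` dom cF.
pose Om := warped_dom I V.
pose G := warped_mx f (gF cF).
pose Nv x := N c (param a x).
pose g := gM a.
pose o : 'I_(1 + n) := lshift n 0.
pose eo : 'rV[R]_(1 + n) := delta_mx 0 o.
pose f0 (y : 'rV[R]_(1 + n)) := f (y 0 o).
pose f1 (y : 'rV[R]_(1 + n)) := derive1 f (y 0 o).
pose f2 (y : 'rV[R]_(1 + n)) := derive1 (derive1 f) (y 0 o).
pose x0 := coord a p.
have odc : open (dom (c : chart (warped_atlas I AF))) by exact: open_setM.
have oU : open U by exact: open_rep_dom.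
have UP x : U x -> exists q, [/\ dom a q, dom (c : chart (warped_atlas I AF)) (psi q),
    x = coord a q & param a x = q].
  by move=> [q [aq cq] <-]; exists q; rewrite paramKa.
have Ux0 : U x0 by exists p.
have UOm x : U x -> Om (Psi x).
  move=> /UP [q [aq cq xq pq]]; rewrite /Om /V -warped_coord_image /Psi /rep pq.
  by exists (psi q).
have sF : smooth_on U Psi by exact: sPsi.
have sk : smooth_mx V (gF cF) by apply: smooth_mx_of => //; exact: sgF.
have symk y : V y -> (gF cF y)^T = gF cF y.
  move=> [q cq <-]; apply/matrixP => i j; rewrite mxE.
  have := symF cF q (delta_mx 0 i) (delta_mx 0 j) cq.
  by rewrite /inner -!rowE !trmx_delta -!colE !mxE.
have posk y (v : 'rV[R]_n) : V y -> v != 0 -> 0 < (v *m gF cF y *m v^T) 0 0.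
  by move=> [q cq <-] v0; exact: posF.
have oV : open V by [].
have oOm : open Om by exact: open_warped_dom.
have sG : smooth_mx Om G by exact: smooth_warped_mx.
have symG y : Om y -> (G y)^T = G y by exact: warped_mx_sym.
have uG y : Om y -> G y \in unitmx by exact: warped_mx_unit.
have sfd : smooth_on I (derive1 f).
  have -> : derive1 f = 'D_1 f by apply/funext => s; rewrite derive1E.
  exact: smooth_on_derive.
have sf0 : smooth_on Om f0 by exact: smooth_time.
have sf1 : smooth_on Om f1 by exact: smooth_time.
have f0_gt0 y : Om y -> 0 < f0 y by move=> [Iy _]; exact: hfpos.
have f0_neq0 y : Om y -> f0 y != 0 by move=> /f0_gt0; exact: lt0r_neq0.
have df0 i y : Om y -> partial i f0 y = (i == o)%:R * f1 y.
  by move=> _; exact: partial_time.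
have df1 i y : Om y -> partial i f1 y = (i == o)%:R * f2 y.
  by move=> _; exact: partial_time.
have wr y : Om y -> eo *m G y = - eo by move=> _; exact: warped_mx_row.
have wd y : Om y -> partial_mx o G y = (2 * (f1 y / f0 y)) *: (G y + eo^T *m eo).
  exact: warped_mx_derive.
have sN : smooth_mx U Nv.
  by apply: smooth_mx_of => //; case: hNfield => _; exact.
have gE x : U x -> g x = jacobian Psi x *m G (Psi x) *m (jacobian Psi x)^T.
  move=> /UP [q [aq cq -> pq]]; rewrite /g (pbM a c q aq cq).
  by rewrite /tangent_mx /G /Psi /rep paramKa.
have symg x : U x -> (g x)^T = g x.
  move=> /UP [q [aq _ -> _]]; apply/matrixP => i j; rewrite mxE.
  have := symM a q (delta_mx 0 i) (delta_mx 0 j) aq.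
  by rewrite /inner -!rowE !trmx_delta -!colE !mxE.
have posg x (v : 'rV[R]_n) : U x -> v != 0 -> 0 < (v *m g x *m v^T) 0 0.
  by move=> /UP [q [aq _ -> _]] v0; exact: posM.
have ug x : U x -> g x \in unitmx.
  by move=> Ux; apply: posdef_unitmx; [exact: symg|move=> v; exact: posg].
have NN x : U x -> Nv x *m G (Psi x) *m (Nv x)^T = (-1)%:M.
  move=> /UP [q [aq cq xq pq]]; have [NN _] := hNnormal a c q aq cq.
  apply/matrixP => i j; rewrite !ord1 [RHS]mxE eqxx mulr1n -NN.
  by rewrite /Nv /Psi /rep pq.
have EN x : U x -> jacobian Psi x *m G (Psi x) *m (Nv x)^T = 0.
  move=> /UP [q [aq cq xq pq]]; have [_ EN] := hNnormal a c q aq cq.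
  apply/matrixP => i j; rewrite ord1 [RHS]mxE -(EN (delta_mx 0 i)).
  by rewrite /inner /Nv /Psi /rep pq -!mulmxA -rowE row_entry /tangent_mx -xq.
have covN q : dom a q -> dom c (psi q) ->
    covariant_derivative psi (warped_metric I f gF) N a c q =
    cov_normal G Psi Nv (coord a q).
  move=> aq cq; apply/matrixP => i l.
  rewrite cov_normal.unlock [LHS]mxE [RHS]mxE covE addmxE partial_mxE.
  apply: (congr2 (fun x y : R => x + y) erefl).
  rewrite exchange_big [RHS]mxE; apply: eq_bigr => s _ /=.
  rewrite summxE mulr_sumr; apply: eq_bigr => r _.
  rewrite scalemxE christoffel_entry /Nv /Psi /rep paramKa // /tangent_mx.
  by rewrite [RHS]mulrC [jacobian _ _ _ _ * _]mulrC.
have trS x : U x -> \tr (shape_mx G Psi g Nv x) = - (n%:R * H).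
  move=> Ux; have [q [aq cq xq pq]] := UP x Ux.
  have := hH a c q aq cq; rewrite /mean_curvature /shape_operator covN // -xq.
  have := weingarten oOm sG symG uG oU sF UOm sN gE ug NN EN Ux => ->.
  have -> : tangent_mx psi a c q = jacobian Psi x by rewrite xq.
  (* The Jacobian of an immersion is row-free, so its pseudo-inverse is a right inverse and recovers
     [shape_mx] from the Weingarten formula. *)
  rewrite opprK mulmxKp; last by have := rfE a c q aq cq; rewrite /tangent_mx -xq.
  move=> <-; rewrite mulrN mulrA mulfV ?mul1r ?opprK // pnatr_eq0.
  by case: (n) hn.
(* This is the product of [N] with d/dt: lowering the time index changes its sign. *)
pose u x := - Nv x 0 o.
have eoT : eo *m eo^T = 1%:M.
  apply/matrixP => i j; rewrite !ord1 -rowE row_entry [eo^T _ _]mxE [eo _ _]mxE.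
  by rewrite [RHS]mxE !eqxx.
have NeoT x : Nv x *m eo^T = (- u x)%:M.
  apply/matrixP => i j; rewrite !ord1 [RHS]mxE eqxx mulr1n opprK.
  by rewrite trmx_delta -colE mxE.
have coshE x : U x -> cosh (phi (param a x)) = u x.
  move=> Ux; have [q [aq cq xq pq]] := UP x Ux.
  rewrite pq (hphi c q cq) /inner dt_delta -/eo.
  have -> : warped_metric I f gF c (coord c (psi q)) = G (Psi x).
    by rewrite /Psi /rep pq.
  have -> : N c q = Nv x by rewrite /Nv pq.
  rewrite -mulmxA.
  have -> : G (Psi x) *m eo^T = - eo^T.
    by rewrite -(symG _ (UOm x Ux)) -trmx_mul wr ?trmxN //; exact: UOm.
  by rewrite mulmxN NeoT oppmxE mxE eqxx mulr1n opprK.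
have cp0 : cosh (phi p) = u x0 by rewrite -coshE // /x0 paramKa.
(* [cosh (phi _)] is identified with [u] only on [U], which is open and hence determines the Hessian
   at [x0]. *)
have lapE : laplacian gM a (fun q => cosh (phi q)) p =
    \tr (invmx (g x0) *m hessian g u x0).
  by rewrite /laplacian (eq_hessian g oU coshE Ux0).
have PsiE : Psi x0 = coord c (psi p) by rewrite /Psi /rep /x0 paramKa.
have timeE : Psi x0 0 o = (psi p).1.
  by rewrite PsiE /= row_mxEl mxE eqxx mulr1n.
pose h x := f1 (Psi x) / f0 (Psi x).
pose t x := jacobian Psi x *m eo^T.
pose T x := (t x)^T *m invmx (g x).
have lap := laplacian_cosh oOm sG symG uG sf0 sf1 f0_neq0 df0 df1 wr wd oU sF UOm
  sN gE ug NN EN trS (fun x => erefl (h x)) (fun x => erefl (u x))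
  (fun x => erefl (t x)) (fun x => erefl (T x)) Ux0.
have Tt := time_gradient_norm symG wr UOm gE ug NN EN (fun x => erefl (u x))
  (fun x => erefl (t x)) (fun x => erefl (T x)) Ux0.
have u1 : 1 <= u x0 ^+ 2.
  by rewrite -cp0 -subr_ge0 -cosh2_sinh2 sqr_ge0.
have Om0 := UOm x0 Ux0.
have ricE : ricci G (Psi x0) *m eo^T =
    - (n%:R * (f2 (Psi x0) / f0 (Psi x0))) *: eo^T.
  exact: (warp_ricci oOm sG symG uG sf0 sf1 f0_neq0 df0 df1 wr wd Om0).
have tcc (z : 'rV[R]_(1 + n)) : (z *m G (Psi x0) *m z^T) 0 0 < 0 ->
    0 <= (z *m ricci G (Psi x0) *m z^T) 0 0.
  by rewrite PsiE; exact: hTCC.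
have [nk0 rnk] := tcc_null (symG _ Om0) (ricci_sym oOm sG symG uG Om0) (wr _ Om0)
  eoT (NN x0 Ux0) (NeoT x0) ricE tcc u1.
have n0 : (0 < n)%N by exact: ltn_trans hn.
have := cosh_laplacian_bound (h x0) (symg x0 Ux0) (fun v => @posg x0 v Ux0)
  (second_form_sym oOm sG symG uG oU sF UOm sN gE ug NN EN Ux0)
  (mulmxKV (ug x0 Ux0) (t x0)^T) Tt (trS x0 Ux0) n0 nk0 rnk u1.
rewrite -lap -lapE -cp0 -cosh2_sinh2 -exprM /h /f1 /f0 timeE.
by rewrite -[(2 * 2)%N]/4%N (expr_div_n (derive1 f _)).
Qed.
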